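(* Let $D$ be an Arakelov divisor on $\overline{\mathrm{Spec}\,\mathbb Z}$ and $K=-2\{2\}$, with $\deg K=-2\log 2$. Then there is an isomorphism of $\mathbb S[\pm1]$-modules $$H^0(K-D)\simeq \underline{\mathrm{Hom}}_{\Gamma\mathcal T_*}\bigl(H^1(D),U(1)_{\frac14}\bigr),$$ where $U(1)_{\frac14}$ coincides with $H^1(K)$, playing the role of the dualizing module in Pontryagin duality.
   Context: Arakelov divisors. An Arakelov divisor on $\overline{\mathrm{Spec}\,\mathbb Z}$ is a formal finite sum $D=\sum_j a_j\{p_j\}+a\{\infty\}$ with $p_j$ distinct rational primes, $a_j\in\mathbb Z$, $a\in\mathbb R$; $\deg D=\sum_j a_j\log p_j+a$. Let $\mathbb A_{\mathbb Q}$ be the adeles of $\mathbb Q$, with $\mathbb Q\subset\mathbb A_{\mathbb Q}$ embedded diagonally. Put $\mathcal O(D)_f=\prod_p \mathcal O(D)_p$ with $\mathcal O(D)_{p_j}=p_j^{-a_j}\mathbb Z_{p_j}$ and $\mathcal O(D)_p=\mathbb Z_p$ for the other primes. $\mathbb S$-modules. $\Gamma^{o}$ is the category with objects the pointed sets $k_+=\{0,1,\dots,k\}$ (base point $*=0$) and all pointed maps. An $\mathbb S$-module is a functor $\Gamma^{o}\to$ pointed sets sending $0_+$ to a point. An $\mathbb S[\pm1]$-module is an $\mathbb S$-module with an action of the group $\{\pm1\}$ by automorphisms. For an abelian group $A$, $HA$ is the $\mathbb S[\pm1]$-module with $HA(k_+)=A^{k}$, where $\phi:k_+\to\ell_+$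 acts by $(HA(\phi)(x))_j=\sum_{i:\phi(i)=j}x_i$, $1\le j\le\ell$, and $\pm1$ acts by $x\mapsto\pm x$. Tolerant modules. A tolerance relation on a set is a reflexive symmetric relation. $\mathcal T_*$ is the category of pointed sets with a tolerance relation, and pointed maps preserving the relations; $\Gamma\mathcal T_*$ is the category of functors $E:\Gamma^{o}\to\mathcal T_*$ with $E(0_+)=*$ (tolerant $\mathbb S$-modules) and natural transformations. A tolerant $\mathbb S[\pm1]$-module is a tolerant $\mathbb S$-module with an action of $\{\pm1\}$ by automorphisms. The internal Hom is $\underline{\mathrm{Hom}}_{\Gamma\mathcal T_*}(E,E')(k_+):=\mathrm{Hom}_{\Gamma\mathcal T_*}(E,E'(k_+\wedge-))$, functorial in $k_+$ by composition, with $\{\pm1\}$ acting through $E'$. $U(1)_\lambda$ ($\lambda>0$) is the tolerant $\mathbb S[\pm1]$-module $H(\mathbb R/\mathbb Z)$ with relations $\mathcal R_k=\{(x,y)\mid\sum_{i=1}^k d(x_i,y_i)\le\lambda\}$ on $(\mathbb R/\mathbb Z)^k$, where $d$ is the translation invariant metric for which $\mathbb R/\mathbb Z$ has length $1$, i.e. $d(x,0)$ is the distance of a lift of $x$ to $\mathbb Z\subset\mathbb R$. Cohomologies. $H^0(D)$ is the $\mathbb S[\pm1]$-module kernel of $(q,b)\mapsto q+b$ on $H\mathbb Q\times H\mathcal O(D)$, where $H\mathcal O(D)(k_+)\subset \mathbb A_{\mathbb Q}^{k}$ consists of the $k$-tuples $(b_1,\dots,b_k)$ of adeles whose finite parts lie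 in $\mathcal O(D)_f$ and whose archimedean components satisfy $\sum_i|b_{i,\infty}|\le e^a$. Explicitly $H^0(D)(k_+)=\{(q_1,\dots,q_k)\in\mathbb Q^k\mid q_i\in\mathcal O(D)_f\ \forall i,\ \sum_i|q_i|\le e^a\}$. $H^1(D)$ is the cokernel of the same map, defined as the tolerant $\mathbb S[\pm1]$-module $(H\mathbb A_{\mathbb Q},\mathcal R)$ with $(x,y)\in\mathcal R_k$ if and only if $x-y=q+b$ for some $q\in\mathbb Q^k$, $b\in H\mathcal O(D)(k_+)$.
   Formalization: ''U(1)_{1/4} coincides with H^1(K)'' cannot be a literal isomorphism (A_Q is torsion-free, R/Z is not); it is stated as a surjective morphism H^1(K) → U(1)_{1/4} preserving and reflecting the tolerance relations, with kernel Q+O(K)_f. *)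

(* Defs.v *)
From HB Require Import structures.
From mathcomp Require Import all_boot all_order all_algebra.
From mathcomp Require Import all_classical all_reals all_analysis.
From mathcomp Require Import ring_quotient fraction freeg.
Set Implicit Arguments.
Unset Strict Implicit.
Unset Printing Implicit Defensive.
Import Order.TTheory GRing.Theory Num.Theory.
Local Open Scope classical_set_scope.
Local Open Scope ring_scope.

Definition primeT := {p : nat | prime p}.
HB.instance Definition _ := Countable.on primeT.
Coercion nat_of_prime (p : primeT) : nat := val p.

Lemma primeTP (p : primeT) : prime p. Proof. exact: valP p. Qed.

Lemma modz_dvdm (m d a : int) : (d %| m)%Z -> ((a %% m)%Z = a %[mod d])%Z.
Proof.
move=> dm; rewrite [in RHS](divz_eq a m) -[in RHS]modzDml.
have /dvdz_mod0P -> : (d %| (a %/ m)%Z * m)%Z by exact: dvdz_mull.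
by rewrite add0r.
Qed.

Section Zp.
Variable p : primeT.

Local Notation P n := ((p ^ n)%N%:Z).

Fact P_dvd m n : (m <= n)%N -> (P m %| P n)%Z.
Proof. by move=> mn; exact: dvdn_exp2l. Qed.

(* Z_p as the inverse limit of the Z/p^n; an element is stored as the sequence
   of its canonical residues 0 <= x n < p^n. *)
Definition coherent (x : nat -> int) : Prop :=
  forall n, x n = (x n.+1 %% (p ^ n)%N%:Z)%Z.

Record padic_int := PadicInt { residue :> nat -> int; _ : `[< coherent residue >] }.
HB.instance Definition _ := [isSub for residue].
HB.instance Definition _ := [Choice of padic_int by <:].

Implicit Types x y z : padic_int.

Fact zpP x n : x n = (x n.+1 %% P n)%Z.
Proof. by case: x => x /= /asboolP. Qed.

Lemma residueK x n : (x n %% (p ^ n)%N%:Z)%Z = x n.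
Proof. by rewrite [x n in RHS]zpP [x n in LHS]zpP modz_mod. Qed.

Lemma padic_ext x y : (forall n, x n = y n) -> x = y.
Proof. by move=> xy; apply/val_inj/funext. Qed.

Definition mod_coherent (f : nat -> int) : Prop :=
  forall n, (f n = f n.+1 %[mod (p ^ n)%N])%Z.

Fact mk_subproof f : mod_coherent f ->
  `[< coherent (fun n => (f n %% (p ^ n)%N%:Z)%Z) >].
Proof.
by move=> Hf; apply/asboolP => n; rewrite modz_dvdm ?P_dvd.
Qed.

Definition mk_padic f (Hf : mod_coherent f) := PadicInt (mk_subproof Hf).

Fact zpM x : mod_coherent x.
Proof. by move=> n; rewrite [x n]zpP modz_mod. Qed.

Fact const_mc (m : int) : mod_coherent (fun=> m). Proof. by []. Qed.
Fact add_mc x y : mod_coherent (fun n => x n + y n).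
Proof. by move=> n; rewrite -modzDm (zpM x) (zpM y) modzDm. Qed.
Fact opp_mc x : mod_coherent (fun n => - x n).
Proof. by move=> n; rewrite -modzNm (zpM x) modzNm. Qed.
Fact mul_mc x y : mod_coherent (fun n => x n * y n).
Proof. by move=> n; rewrite -modzMm (zpM x) (zpM y) modzMm. Qed.

Definition zp0 := mk_padic (const_mc 0).
Definition zp1 := mk_padic (const_mc 1).
Definition zpadd x y := mk_padic (add_mc x y).
Definition zpopp x := mk_padic (opp_mc x).
Definition zpmul x y := mk_padic (mul_mc x y).

Fact zpaddA : associative zpadd.
Proof. by move=> x y z; apply: padic_ext => n /=; rewrite modzDml modzDmr addrA. Qed.
Fact zpaddC : commutative zpadd.
Proof. by move=> x y; apply: padic_ext => n /=; rewrite addrC. Qed.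
Fact zpadd0 : left_id zp0 zpadd.
Proof. by move=> x; apply: padic_ext => n /=; rewrite modzDml add0r residueK. Qed.
Fact zpaddN : left_inverse zp0 zpopp zpadd.
Proof. by move=> x; apply: padic_ext => n /=; rewrite modzDml addNr. Qed.

HB.instance Definition _ :=
  GRing.isZmodule.Build padic_int zpaddA zpaddC zpadd0 zpaddN.

Fact zpmulA : associative zpmul.
Proof. by move=> x y z; apply: padic_ext => n /=; rewrite modzMml modzMmr mulrA. Qed.
Fact zpmulC : commutative zpmul.
Proof. by move=> x y; apply: padic_ext => n /=; rewrite mulrC. Qed.
Fact zpmul1 : left_id zp1 zpmul.
Proof. by move=> x; apply: padic_ext => n /=; rewrite modzMml mul1r residueK. Qed.
Fact zpmulD : left_distributive zpmul +%R.
Proof.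
by move=> x y z; apply: padic_ext => n /=; rewrite modzMml modzDml modzDmr mulrDl.
Qed.
Fact zp1_neq0 : zp1 != 0.
Proof.
apply/eqP => /(congr1 (fun x : padic_int => x 1%N)) /=.
by rewrite mod0z expn1 modz_small // ltz_nat prime_gt1 ?primeTP.
Qed.

HB.instance Definition _ := GRing.Zmodule_isComNzRing.Build padic_int
  zpmulA zpmulC zpmul1 zpmulD zp1_neq0.

Lemma padic0E n : (0 : padic_int) n = 0. Proof. by rewrite /= mod0z. Qed.
Lemma padic1E n : (1 : padic_int) n = (1 %% (p ^ n)%N%:Z)%Z. Proof. by []. Qed.
Lemma padicDE x y n : (x + y) n = ((x n + y n) %% (p ^ n)%N%:Z)%Z.
Proof. by []. Qed.
Lemma padicNE x n : (- x) n = ((- x n) %% (p ^ n)%N%:Z)%Z.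
Proof. by []. Qed.
Lemma padicME x y n : (x * y) n = ((x n * y n) %% (p ^ n)%N%:Z)%Z.
Proof. by []. Qed.
Lemma padic_intrE (m : int) n : (m%:~R : padic_int) n = (m %% (p ^ n)%N%:Z)%Z.
Proof.
have natE (k : nat) : (k%:R : padic_int) n = (k%:Z %% (p ^ n)%N%:Z)%Z.
  elim: k => [|k IH]; first by rewrite padic0E mod0z.
  by rewrite -addn1 natrD padicDE IH padic1E modzDm PoszD.
case: m => k; first exact: natE.
by rewrite NegzE mulrNz padicNE natE modzNm.
Qed.

Definition zpunit := [pred x : padic_int | `[< exists y, y * x = 1 >]].
Definition zpinv x : padic_int :=
  if pselect (exists y, y * x = 1) is left e then projT1 (cid e) else x.
Fact zpmulV : {in zpunit, left_inverse 1 zpinv *%R}.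
Proof.
move=> x /asboolP ux; rewrite /zpinv; case: pselect => // e.
exact: projT2 (cid e).
Qed.
Fact zpunitP x y : y * x = 1 -> zpunit x.
Proof. by move=> yx; apply/asboolP; exists y. Qed.
Fact zpinv_out : {in [predC zpunit], zpinv =1 id}.
Proof.
by move=> x /asboolPn ux; rewrite /zpinv; case: pselect.
Qed.
HB.instance Definition _ := GRing.ComNzRing_hasMulInverse.Build padic_int
  zpmulV zpunitP zpinv_out.

Fact zp_low x m n : (m <= n)%N -> x m = (x n %% P m)%Z.
Proof.
move=> /subnK <-; elim: (n - m)%N => [|k IH]; first by rewrite residueK.
by rewrite IH addSn [x (k + m)%N]zpP modz_dvdm ?P_dvd ?leq_addl.
Qed.

Fact zp_integral : GRing.integral_domain_axiom padic_int.
Proof.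
move=> x y xy0; apply/contraT; rewrite negb_or.
have nz z : z != 0 -> exists n, ~~ (P n %| z n)%Z.
  move=> /eqP z0; apply: contrapT => H; apply: z0; apply: padic_ext => n.
  rewrite padic0E -residueK; apply/dvdz_mod0P.
  by apply: contrapT => /negP nd; apply: H; exists n; exact: nd.
case/andP => /nz[n xn] /nz[m ym].
have := congr1 (fun z : padic_int => z (n + m)%N) xy0.
rewrite padic0E padicME; set N := (n + m)%N.
move/dvdz_mod0P => dv.
have xN : ~~ (P n %| x N)%Z.
  by apply: contra xn => /dvdz_mod0P; rewrite -zp_low ?leq_addr// => ->; rewrite dvdz0.
have yN : ~~ (P m %| y N)%Z.
  by apply: contra ym => /dvdz_mod0P; rewrite -zp_low ?leq_addl// => ->; rewrite dvdz0.
have {dv} : (p ^ N %| `|x N| * `|y N|)%N by rewrite -abszM; exact: dv.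
have {}xN : ~~ (p ^ n %| `|x N|)%N by exact: xN.
have {}yN : ~~ (p ^ m %| `|y N|)%N by exact: yN.
have x0 : (0 < `|x N|)%N by rewrite lt0n; apply/eqP => e; move: xN; rewrite e dvdn0.
have y0 : (0 < `|y N|)%N by rewrite lt0n; apply/eqP => e; move: yN; rewrite e dvdn0.
move: xN yN; rewrite !pfactor_dvdn ?primeTP// ?muln_gt0 ?x0// lognM//.
rewrite -!ltnNge => xN yN; rewrite leqNgt => /negP[].
by rewrite -addSn leq_add // ltnW.
Qed.
HB.instance Definition _ := GRing.ComUnitRing_isIntegral.Build padic_int zp_integral.

End Zp.

Notation Qp p := {fraction (padic_int p)}.

Section Qp.
Variable p : primeT.

Lemma padic_intr_eq0 (m : int) : ((m%:~R : padic_int p) == 0) = (m == 0).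
Proof.
apply/eqP/eqP => [m0|->//].
have H n : (p ^ n %| `|m|)%N.
  have := congr1 (fun x : padic_int p => x n) m0.
  by rewrite padic_intrE padic0E => /dvdz_mod0P.
apply/eqP; rewrite -absz_eq0; apply/contraT; rewrite -lt0n => m_gt0.
have := dvdn_leq m_gt0 (H `|m|%N).
by rewrite leqNgt ltn_expl // prime_gt1 ?primeTP.
Qed.

Lemma Qp_intr_eq0 (m : int) : ((m%:~R : Qp p) == 0) = (m == 0).
Proof. by rewrite -[m%:~R](rmorph_int (@tofrac (padic_int p))) tofrac_eq0 padic_intr_eq0. Qed.

Lemma ratr_Qp_frac (n d : int) : d != 0 ->
  ratr (n%:~R / d%:~R) = n%:~R / d%:~R :> Qp p.
Proof.
move=> d0; set q : rat := _ / _.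
have dq0 : ((denq q)%:~R : Qp p) != 0 by rewrite Qp_intr_eq0 denq_neq0.
have d0' : (d%:~R : Qp p) != 0 by rewrite Qp_intr_eq0.
apply/eqP; rewrite /ratr (eqr_div _ _ dq0 d0') -!intrM.
suff -> : numq q * d = n * denq q by [].
apply: (@intr_inj rat); rewrite !intrM numqE mulrAC {1}/q.
by rewrite divfK ?intr_eq0.
Qed.

Lemma ratr_QpB : {morph (@ratr (Qp p)) : x y / x - y}.
Proof.
move=> x y; rewrite -(divq_num_den x) -(divq_num_den y).
have dx := denq_neq0 x; have dy := denq_neq0 y.
have inj0 d : d != 0 -> (d%:~R : Qp p) != 0 by rewrite Qp_intr_eq0.
rewrite -mulNr addf_div ?intr_eq0 // -intrN -!intrM -intrD.
rewrite !ratr_Qp_frac ?mulf_neq0 //.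
rewrite -[in RHS]mulNr addf_div ?inj0 // -intrN -!intrM -intrD.
by [].
Qed.

Definition pZp (m : int) : set (Qp p) :=
  [set x | exists z : padic_int p, x = (p%:R : Qp p) ^ m * tofrac z].

Lemma pZp_0 m : pZp m 0.
Proof. by exists 0; rewrite tofrac0 mulr0. Qed.
Lemma pZpD m x y : pZp m x -> pZp m y -> pZp m (x + y).
Proof. by move=> [z ->] [t ->]; exists (z + t); rewrite tofracD mulrDr. Qed.
Lemma pZpN m x : pZp m x -> pZp m (- x).
Proof. by move=> [z ->]; exists (- z); rewrite tofracN mulrN. Qed.

Lemma pZp_ratr (q : rat) : ~~ (p %| `|denq q|)%N -> pZp 0 (ratr q).
Proof.
move=> pd.
have cop n : coprimez (denq q) (p ^ n)%N.
  by rewrite coprimezE coprime_sym coprimeXl // prime_coprime // primeTP.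
pose u n := (egcdz (denq q) (p ^ n)%N).1.
have uP n : (u n * denq q = 1 %[mod (p ^ n)%N])%Z.
  rewrite /u; case: egcdzP => v w /= e _; move: (cop n) => /eqP g1.
  by rewrite g1 in e; rewrite -e addrC modzMDl.
have Hf : mod_coherent p (fun n => u n * numq q).
  move=> n; suff e : (u n = u n.+1 %[mod (p ^ n)%N])%Z by rewrite -modzMml e modzMml.
  have e1 := uP n.
  have e2 : (u n.+1 * denq q = 1 %[mod (p ^ n)%N])%Z.
    have dv : ((p ^ n)%N%:Z %| (p ^ n.+1)%N%:Z)%Z by apply: dvdn_exp2l.
    by rewrite -(modz_dvdm _ dv) uP modz_dvdm.
  apply/eqP; rewrite eqz_mod_dvd -(Gauss_dvdzr _ (m := (p ^ n)%N) (n := denq q)).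
    by rewrite mulrBr -eqz_mod_dvd ![denq q * _]mulrC e1 e2.
  by rewrite coprimez_sym.
exists (mk_padic Hf); rewrite expr0z mul1r.
have d0 : ((denq q)%:~R : Qp p) != 0 by rewrite Qp_intr_eq0 denq_neq0.
apply: (canLR (mulfK d0)).
rewrite -!(rmorph_int (@tofrac (padic_int p))) -tofracM; congr tofrac; apply: padic_ext => n.
rewrite padicME !padic_intrE /= modzMm mulrAC -modzMml uP modzMml mul1r.
by [].
Qed.

End Qp.

Section FiniteAdele.

(* The finite adeles: the restricted product of the Q_p with respect to Z_p. *)
Definition restricted (x : forall p : primeT, Qp p) : Prop :=
  finite_set [set p | ~ pZp 0 (x p)].

Record finite_adele := FiniteAdele {
  component :> forall p : primeT, Qp p;
  _ : `[< restricted component >] }.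
HB.instance Definition _ := [isSub for component].
HB.instance Definition _ := [Choice of finite_adele by <:].

Implicit Types x y z : finite_adele.

Fact faP x : restricted x. Proof. by case: x => x /= /asboolP. Qed.
Lemma fa_ext x y : (forall p, x p = y p) -> x = y.
Proof. by move=> xy; apply/val_inj/functional_extensionality_dep. Qed.

Fact fa0_subproof : `[< restricted (fun=> 0) >].
Proof.
apply/asboolP; rewrite /restricted (_ : [set _ | _] = set0) //.
by rewrite -subset0 => p /= []; exact: pZp_0.
Qed.
Fact faN_subproof x : `[< restricted (fun p => - x p) >].
Proof.
apply/asboolP; apply: sub_finite_set (faP x) => p /= H G; apply: H.
exact: pZpN.
Qed.
Fact faD_subproof x y : `[< restricted (fun p => x p + y p) >].
Proof.
apply/asboolP.
apply: (@sub_finite_set _ _ ([set p | ~ pZp 0 (x p)] `|` [set p | ~ pZp 0 (y p)])).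
  move=> p /= H; apply: contrapT => /not_orP[/contrapT xp /contrapT yp].
  by apply: H; exact: pZpD.
by rewrite finite_setU; split; exact: faP.
Qed.

Definition fa0 := FiniteAdele fa0_subproof.
Definition faN x := FiniteAdele (faN_subproof x).
Definition faD x y := FiniteAdele (faD_subproof x y).

Fact faDA : associative faD.
Proof. by move=> x y z; apply: fa_ext => p /=; rewrite addrA. Qed.
Fact faDC : commutative faD.
Proof. by move=> x y; apply: fa_ext => p /=; rewrite addrC. Qed.
Fact faD0 : left_id fa0 faD.
Proof. by move=> x; apply: fa_ext => p /=; rewrite add0r. Qed.
Fact faDN : left_inverse fa0 faN faD.
Proof. by move=> x; apply: fa_ext => p /=; rewrite addNr. Qed.
HB.instance Definition _ := GRing.isZmodule.Build finite_adele faDA faDC faD0 faDN.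

Lemma fa0E p : (0 : finite_adele) p = 0. Proof. by []. Qed.
Lemma faNE x p : (- x) p = - x p. Proof. by []. Qed.
Lemma faDE x y p : (x + y) p = x p + y p. Proof. by []. Qed.

Fact diag_subproof (q : rat) : `[< restricted (fun p => ratr q) >].
Proof.
apply/asboolP.
apply: (@sub_finite_set _ _ [set p : primeT | ((p : nat) < `|denq q|.+1)%N]).
  move=> p /= H; apply: contrapT => /negP; rewrite -leqNgt => lt; apply: H.
  apply: pZp_ratr; rewrite gtnNdvd // absz_gt0; exact: denq_neq0.
apply: (@finite_preimage _ _ `I_(`|denq q|.+1) (fun p : primeT => (p : nat))).
  by move=> p p' _ _ /val_inj.
exact: finite_II.
Qed.
Definition finite_diag (q : rat) := FiniteAdele (diag_subproof q).

Lemma finite_diag_is_zmod_morphism : zmod_morphism finite_diag.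
Proof. by move=> q r; apply: fa_ext => p; exact: ratr_QpB. Qed.
HB.instance Definition _ :=
  GRing.isZmodMorphism.Build rat finite_adele finite_diag finite_diag_is_zmod_morphism.

End FiniteAdele.

Notation adele R := (finite_adele * R)%type.

Section Arakelov.
Variable R : realType.

Definition diag (q : rat) : adele R := (finite_diag q, ratr q).
Lemma diag_is_zmod_morphism : zmod_morphism diag.
Proof. by move=> q r; rewrite /diag !raddfB. Qed.
HB.instance Definition _ :=
  GRing.isZmodMorphism.Build rat (adele R) diag diag_is_zmod_morphism.

(* D.1 is the finite part \sum_j a_j {p_j}, D.2 the coefficient of {infty}. *)
Definition arakelov := ({freeg primeT / int} * R)%type.
HB.instance Definition _ := GRing.Zmodule.on arakelov.

Definition arakelov_deg (D : arakelov) : R :=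
  \sum_(p <- (dom D.1 : seq primeT)) (coeff p D.1)%:~R * ln p%:R + D.2.

Definition Ofin (D : arakelov) : set finite_adele :=
  [set x | forall p, pZp (- coeff p D.1) (x p)].

Lemma Ofin0 D : Ofin D 0. Proof. by move=> p; exact: pZp_0. Qed.
Lemma OfinD D x y : Ofin D x -> Ofin D y -> Ofin D (x + y).
Proof. by move=> Hx Hy p; exact: pZpD. Qed.
Lemma OfinN D x : Ofin D x -> Ofin D (- x).
Proof. by move=> Hx p; exact: pZpN. Qed.
Lemma Ofin_sum D (I : finType) (P : pred I) (F : I -> finite_adele) :
  (forall i, Ofin D (F i)) -> Ofin D (\sum_(i | P i) F i).
Proof. by move=> HF; apply: big_ind => //; [exact: Ofin0|exact: OfinD]. Qed.

End Arakelov.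

(* The category Gamma^o; k_+ = {0, ..., k} is 'I_k.+1 with base point ord0. *)
Record gmap (k l : nat) := GMap {
  gfun :> 'I_k.+1 -> 'I_l.+1;
  gfun0 : gfun ord0 = ord0 }.

Lemma gmap_ext k l (f g : gmap k l) : f =1 g -> f = g.
Proof.
case: f g => f f0 [g g0] /= /funext fg; rewrite fg in f0 *.
by congr GMap; exact: Prop_irrelevance.
Qed.

Definition gid k : gmap k k := @GMap k k id erefl.
Definition gcomp k l m (g : gmap l m) (f : gmap k l) : gmap k m :=
  @GMap k m (g \o f) (etrans (congr1 g (gfun0 f)) (gfun0 g)).

Section Smash.

(* k_+ /\ n_+ is identified with (k * n)_+ through the enumeration
   mxvec_index of 'I_k * 'I_n; smash_pt is the canonical map
   k_+ x n_+ -> k_+ /\ n_+ *)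
Definition smash_pt k n (a : 'I_k.+1) (b : 'I_n.+1) : 'I_(k * n).+1 :=
  match fintype.unlift ord0 a, fintype.unlift ord0 b with
  | Some i, Some j => fintype.lift ord0 (mxvec_index i j)
  | _, _ => ord0
  end.

Definition unsmash k n (c : 'I_(k * n)) : 'I_k * 'I_n :=
  enum_val (cast_ord (esym (mxvec_cast k n)) c).

Lemma mxvec_indexK k n (i : 'I_k) (j : 'I_n) : unsmash (mxvec_index i j) = (i, j).
Proof. by rewrite /unsmash /mxvec_index cast_ordK enum_rankK. Qed.

Lemma unsmashK k n (c : 'I_(k * n)) :
  mxvec_index (unsmash c).1 (unsmash c).2 = c.
Proof. by case/mxvec_indexP: c => i j; rewrite mxvec_indexK. Qed.

Definition smash_fun k k' n n' (f : gmap k k') (g : gmap n n')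
    (x : 'I_(k * n).+1) : 'I_(k' * n').+1 :=
  match fintype.unlift ord0 x with
  | Some c => smash_pt (f (fintype.lift ord0 (unsmash c).1)) (g (fintype.lift ord0 (unsmash c).2))
  | None => ord0
  end.

Lemma smash_fun0 k k' n n' (f : gmap k k') (g : gmap n n') :
  smash_fun f g ord0 = ord0.
Proof. by rewrite /smash_fun unlift_none. Qed.

Definition smash k k' n n' (f : gmap k k') (g : gmap n n') :
  gmap (k * n) (k' * n') := GMap (smash_fun0 f g).

Lemma smash_pt0r k n (a : 'I_k.+1) : smash_pt a (@ord0 n) = ord0.
Proof. by rewrite /smash_pt unlift_none; case: fintype.unlift. Qed.
Lemma smash_pt0l k n (b : 'I_n.+1) : smash_pt (@ord0 k) b = ord0.
Proof. by rewrite /smash_pt unlift_none. Qed.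

Lemma smashE k k' n n' (f : gmap k k') (g : gmap n n') a b :
  smash f g (smash_pt a b) = smash_pt (f a) (g b).
Proof.
case: (unliftP ord0 a) => [i|] ->; last by rewrite smash_pt0l !gfun0 smash_pt0l.
case: (unliftP ord0 b) => [j|] ->; last by rewrite smash_pt0r !gfun0 smash_pt0r.
by rewrite {1}/smash_pt !liftK /= /smash_fun liftK mxvec_indexK.
Qed.

Lemma smash_pt_surj k n (c : 'I_(k * n).+1) : exists a b, c = smash_pt a b.
Proof.
case: (unliftP ord0 c) => [d|] ->; last by exists ord0, ord0; rewrite smash_pt0l.
exists (fintype.lift ord0 (unsmash d).1), (fintype.lift ord0 (unsmash d).2).
by rewrite /smash_pt !liftK unsmashK.
Qed.

Lemma smash_id k n : smash (gid k) (gid n) = gid (k * n).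
Proof.
by apply: gmap_ext => c; have [a [b ->]] := smash_pt_surj c; rewrite smashE.
Qed.
Lemma smash_comp k k' k'' n n' n'' (f' : gmap k' k'') (f : gmap k k')
    (g' : gmap n' n'') (g : gmap n n') :
  smash (gcomp f' f) (gcomp g' g) = gcomp (smash f' g') (smash f g).
Proof.
apply: gmap_ext => c; have [a [b ->]] := smash_pt_surj c.
by rewrite smashE /= [smash_fun f g _]smashE [smash_fun f' g' _]smashE.
Qed.

End Smash.

(* S-modules: functors from Gamma^o to pointed sets with a one-point value at
   0_+. *)
Record Smodule := Smod {
  sobj :> nat -> Type;
  sbase : forall k, sobj k;
  smap : forall k l, gmap k l -> sobj k -> sobj l;
  smap_base : forall k l (f : gmap k l), smap f (sbase k) = sbase l;
  smap_id : forall k (x : sobj k), smap (gid k) x = x;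
  smap_comp : forall k l m (g : gmap l m) (f : gmap k l) (x : sobj k),
    smap (gcomp g f) x = smap g (smap f x);
  sobj0 : forall x : sobj 0, x = sbase 0 }.
Arguments sbase : clear implicits.
Arguments smap E [k l] f x : rename.

Record SmoduleHom (E F : Smodule) := Smor {
  smor_fun :> forall k, E k -> F k;
  smor_base : forall k, smor_fun (sbase E k) = sbase F k;
  smor_nat : forall k l (f : gmap k l) (x : E k),
    smor_fun (smap E f x) = smap F f (smor_fun x) }.

(* Action of {+1, -1} by automorphisms: s : bool stands for (-1) ^+ s, so the
   group law is addb. "Signed" S-modules are the S[+-1]-modules. *)
Record sign_action (E : Smodule) := SignAction {
  sact : bool -> forall k, E k -> E k;
  sact_base : forall s k, sact s (sbase E k) = sbase E k;
  sact_nat : forall s k l (f : gmap k l) (x : E k),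
    sact s (smap E f x) = smap E f (sact s x);
  sact1 : forall k (x : E k), sact false x = x;
  sactM : forall s t k (x : E k), sact (s (+) t) x = sact s (sact t x) }.

Record SignedSmodule := Spmod { spmod_smod :> Smodule; ssign : sign_action spmod_smod }.

Record SignedHom (E F : SignedSmodule) := Spmor {
  spmor_smor :> SmoduleHom E F;
  spmor_sign : forall s k (x : E k),
    spmor_smor k (sact (ssign E) s x) = sact (ssign F) s (spmor_smor k x) }.

Definition signed_iso (E F : SignedSmodule) : Prop :=
  exists (f : SignedHom E F) (g : SignedHom F E),
    forall k, cancel (f k) (g k) /\ cancel (g k) (f k).

Record TolSmodule := Tmod {
  tmod_smod :> Smodule;
  tol : forall k, tmod_smod k -> tmod_smod k -> Prop;
  tol_refl : forall k (x : tmod_smod k), tol x x;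
  tol_sym : forall k (x y : tmod_smod k), tol x y -> tol y x;
  tol_smap : forall k l (f : gmap k l) (x y : tmod_smod k),
    tol x y -> tol (smap tmod_smod f x) (smap tmod_smod f y) }.

Record TolHom (E F : TolSmodule) := Tmor {
  tmor_smor :> SmoduleHom E F;
  tmor_tol : forall k (x y : E k), tol x y -> tol (tmor_smor k x) (tmor_smor k y) }.

Record TolSignedSmodule := Tspmod {
  tspmod_tmod :> TolSmodule;
  tsign : sign_action tspmod_tmod;
  tsign_tol : forall s k (x y : tspmod_tmod k),
    tol x y -> tol (sact tsign s x) (sact tsign s y) }.

Record TolSignedHom (E F : TolSignedSmodule) := Tspmor {
  tspmor_tmor :> TolHom E F;
  tspmor_sign : forall s k (x : E k),
    tspmor_tmor k (sact (tsign E) s x) = sact (tsign F) s (tspmor_tmor k x) }.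

Lemma tmor_ext (E F : TolSmodule) (u v : TolHom E F) :
  (forall k (x : E k), u k x = v k x) -> u = v.
Proof.
case: u v => [[u ub un] ut] [[v vb vn] vt] /= uv.
have e : u = v by apply: functional_extensionality_dep => k; apply/funext => x.
rewrite e in ub un ut *.
have -> : ub = vb by exact: Prop_irrelevance.
have -> : un = vn by exact: Prop_irrelevance.
by congr Tmor; exact: Prop_irrelevance.
Qed.

Section Shift.
Variables (n : nat) (E : TolSmodule).

Definition shift_smod : Smodule.
Proof.
refine (@Smod (fun k => E (n * k)%N) (fun k => sbase E (n * k)%N)
  (fun k l f => smap E (smash (gid n) f)) _ _ _ _).
- by move=> k l f; exact: smap_base.
- by move=> k x; rewrite smash_id smap_id.
- by move=> k l m g f x; rewrite -smap_comp -smash_comp; congr (smap E (smash _ _) x);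
     exact: gmap_ext.
- by rewrite muln0; exact: sobj0.
Defined.

(* The functor E(n_+ /\ -). *)
Definition shift : TolSmodule.
Proof.
refine (@Tmod shift_smod (fun k => @tol E (n * k)%N) _ _ _).
- by move=> k x; exact: tol_refl.
- by move=> k x y; exact: tol_sym.
- by move=> k l f x y; exact: tol_smap.
Defined.

End Shift.

Section IHom.
Variables (E : TolSmodule) (F : TolSignedSmodule).

Definition ihom_base k : TolHom E (shift k F).
Proof.
unshelve refine (@Tmor _ (shift k F) (@Smor E (shift k F) (fun n _ => sbase F (k * n)%N) _ _) _).
- by [].
- by move=> n m f x; rewrite /= smap_base.
- by move=> n x y _; exact: tol_refl.
Defined.

Definition ihom_map k l (f : gmap k l) (u : TolHom E (shift k F)) : TolHom E (shift l F).
Proof.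
unshelve refine (@Tmor _ (shift l F) (@Smor E (shift l F)
  (fun n x => smap F (smash f (gid n)) (u n x)) _ _) _).
- by move=> n; rewrite smor_base; exact: (@smap_base F).
- move=> n m g x; rewrite smor_nat /= -!smap_comp -!smash_comp.
  by congr (smap F (smash _ _) (u n x)); exact: gmap_ext.
- by move=> n x y xy; apply: (@tol_smap F); exact: (tmor_tol u xy).
Defined.

Definition ihom_act (s : bool) k (u : TolHom E (shift k F)) : TolHom E (shift k F).
Proof.
unshelve refine (@Tmor _ (shift k F) (@Smor E (shift k F) (fun n x => sact (tsign F) s (u n x)) _ _) _).
- by move=> n; rewrite smor_base; exact: (sact_base (tsign F)).
- by move=> n m g x; rewrite smor_nat; exact: (sact_nat (tsign F)).
- by move=> n x y xy; apply: (@tsign_tol F); exact: (tmor_tol u xy).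
Defined.

Definition ihom_smod : Smodule.
Proof.
refine (@Smod (fun k => TolHom E (shift k F)) ihom_base ihom_map _ _ _ _).
- by move=> k l f; apply: tmor_ext => n x; exact: (@smap_base F).
- by move=> k u; apply: tmor_ext => n x /=; rewrite smash_id smap_id.
- move=> k l m g f u; apply: tmor_ext => n x /=; rewrite -smap_comp -smash_comp.
  by congr (smap F (smash _ _) _); exact: gmap_ext.
- by move=> u; apply: tmor_ext => n x; exact: (@sobj0 F).
Defined.

(* Hom (E, F (k_+ /\ -)), functorial in k_+, signs acting through F *)
Definition ihom : SignedSmodule.
Proof.
unshelve refine (@Spmod ihom_smod (@SignAction ihom_smod ihom_act _ _ _ _)).
- by move=> s k; apply: tmor_ext => n x; exact: (sact_base (tsign F)).
- by move=> s k l f u; apply: tmor_ext => n x; exact: (sact_nat (tsign F)).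
- by move=> k u; apply: tmor_ext => n x; exact: (sact1 (tsign F)).
- by move=> s t k u; apply: tmor_ext => n x; exact: (sactM (tsign F)).
Defined.

End IHom.

Section HA.
Variable A : zmodType.

Definition Hmap k l (f : gmap k l) (x : {ffun 'I_k -> A}) : {ffun 'I_l -> A} :=
  [ffun j => \sum_(i < k | f (fintype.lift ord0 i) == fintype.lift ord0 j) x i].

Definition Hact (s : bool) k (x : {ffun 'I_k -> A}) : {ffun 'I_k -> A} :=
  if s then - x else x.

Lemma Hmap_is_zmod_morphism k l (f : gmap k l) : zmod_morphism (Hmap f).
Proof.
by move=> x y; apply/ffunP => j; rewrite !ffunE -sumrB; apply: eq_bigr => i _; rewrite !ffunE.
Qed.
HB.instance Definition _ k l (f : gmap k l) :=
  GRing.isZmodMorphism.Build {ffun 'I_k -> A} {ffun 'I_l -> A} (Hmap f)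
    (Hmap_is_zmod_morphism f).

Lemma Hmap_id k (x : {ffun 'I_k -> A}) : Hmap (gid k) x = x.
Proof.
by apply/ffunP => j; rewrite ffunE (big_pred1 j).
Qed.

Lemma Hmap_comp k l m (g : gmap l m) (f : gmap k l) x :
  Hmap (gcomp g f) x = Hmap g (Hmap f x).
Proof.
apply/ffunP => j; rewrite !ffunE.
under [RHS]eq_bigr do rewrite ffunE.
rewrite [RHS](exchange_big_dep xpredT) //= [LHS]big_mkcond /=.
apply: eq_bigr => i _.
case: (unliftP ord0 (f (fintype.lift ord0 i))) => [i'|] -> /=.
  case: ifPn => gj.
    rewrite (big_pred1 i') // => a /=.
    by apply/andP/eqP => [[_ /eqP/lift_inj]|->]; rewrite ?gj ?eqxx.
  rewrite big_pred0 // => a; apply/negP => /andP[ga /eqP/lift_inj e].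
  by move: gj; rewrite e ga.
by rewrite gfun0 (negbTE (neq_lift _ _)) big_pred0 // => a; rewrite andbF.
Qed.

Lemma Hact_nat s k l (f : gmap k l) x : Hact s (Hmap f x) = Hmap f (Hact s x).
Proof. by case: s; rewrite //= raddfN. Qed.

Lemma ffun_ord0 (x : {ffun 'I_0 -> A}) : x = 0.
Proof. by apply/ffunP => -[]. Qed.

Definition H_smod : Smodule :=
  @Smod (fun k => {ffun 'I_k -> A}) (fun k => 0) Hmap
    (fun k l f => raddf0 _) Hmap_id Hmap_comp ffun_ord0.

Lemma Hact0 s k : Hact s (0 : {ffun 'I_k -> A}) = 0.
Proof. by case: s; rewrite //= oppr0. Qed.
Lemma HactM s t k (x : {ffun 'I_k -> A}) : Hact (s (+) t) x = Hact s (Hact t x).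
Proof. by case: s; case: t; rewrite //= opprK. Qed.

Definition H_sign : sign_action H_smod :=
  @SignAction H_smod Hact Hact0 Hact_nat (fun k x => erefl) HactM.

Lemma Hmap_norm_le (R : realType) (N : A -> R) k l (f : gmap k l)
    (x : {ffun 'I_k -> A}) :
  N 0 = 0 -> (forall a, 0 <= N a) -> (forall a b, N (a + b) <= N a + N b) ->
  \sum_(j < l) N (Hmap f x j) <= \sum_(i < k) N (x i).
Proof.
move=> N0 N_ge0 ND.
have Nsum (P : pred 'I_k) : N (\sum_(i | P i) x i) <= \sum_(i | P i) N (x i).
  apply: (big_ind2 (fun a b => N a <= b)) => // [|a b c d ab cd].
    by rewrite N0.
  by apply: le_trans (ND _ _) _; exact: lerD.
apply: (@le_trans _ _ (\sum_(j < l)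
   \sum_(i < k | f (fintype.lift ord0 i) == fintype.lift ord0 j) N (x i))).
  by apply: ler_sum => j _; rewrite ffunE.
rewrite (exchange_big_dep xpredT) //=; apply: ler_sum => i _.
case: (unliftP ord0 (f (fintype.lift ord0 i))) => [i'|] -> /=.
  by rewrite (big_pred1 i') // => j; rewrite (inj_eq lift_inj) eq_sym.
by rewrite big_pred0 // => j; rewrite (negbTE (neq_lift _ _)).
Qed.

End HA.

Definition H (A : zmodType) : SignedSmodule := Spmod (H_sign A).

Section U1.
Variable R : realType.

Definition integers : {pred R} := fun r => r \is a Num.int.
Lemma integers_zmod_closed : zmod_closed integers.
Proof. by split=> [|x y]; [exact: rpred0|exact: rpredB]. Qed.
HB.instance Definition _ := GRing.isZmodClosed.Build R integers integers_zmod_closed.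

Definition RmodZ := Quotient.quot integers.
HB.instance Definition _ := GRing.Zmodule.on RmodZ.

Definition distZ (r : R) : R := inf [set `|r - n%:~R| | n in [set: int]].
Definition norm_RmodZ (x : RmodZ) : R := distZ (repr x).

Lemma distZ_le r (n : int) : distZ r <= `|r - n%:~R|.
Proof.
by apply: ge_inf; [exists 0 => _ [m _ <-]|exists n].
Qed.
Lemma distZ_glb r (c : R) : (forall n : int, c <= `|r - n%:~R|) -> c <= distZ r.
Proof.
move=> Hc; apply: lb_le_inf; first by exists `|r - 0%:~R|, 0.
by move=> _ [n _ <-].
Qed.
Lemma distZ_ge0 r : 0 <= distZ r. Proof. exact: distZ_glb. Qed.
Lemma distZ0 : distZ 0 = 0.
Proof.
apply/eqP; rewrite eq_le distZ_ge0 andbT.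
by apply: le_trans (distZ_le 0 0) _; rewrite subr0 normr0.
Qed.
Lemma distZN r : distZ (- r) = distZ r.
Proof.
suff le s : distZ (- s) <= distZ s.
  by apply/eqP; rewrite eq_le le -{1}[r]opprK le.
apply: distZ_glb => n; apply: le_trans (distZ_le _ (- n)) _.
by rewrite intrN -opprD normrN.
Qed.
Lemma distZD r s : distZ (r + s) <= distZ r + distZ s.
Proof.
rewrite -lerBlDr; apply: distZ_glb => n; rewrite lerBlDr -lerBlDl.
apply: distZ_glb => m; rewrite lerBlDl.
apply: le_trans (distZ_le _ (n + m)) _.
by rewrite intrD opprD addrACA ler_normD.
Qed.
Lemma distZDz r (n : int) : distZ (r + n%:~R) = distZ r.
Proof.
have int0 m : distZ m%:~R = 0.
  apply/eqP; rewrite eq_le distZ_ge0 andbT.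
  by apply: le_trans (distZ_le _ m) _; rewrite subrr normr0.
apply/eqP; rewrite eq_le; apply/andP; split.
  by apply: le_trans (distZD _ _) _; rewrite int0 addr0.
rewrite -{1}[r](addrK n%:~R); apply: le_trans (distZD _ _) _.
by rewrite distZN int0 addr0.
Qed.

Lemma norm_pi (r : R) : norm_RmodZ (\pi_RmodZ r)%qT = distZ r.
Proof.
rewrite /norm_RmodZ.
have /intrP[n e] : repr (\pi_RmodZ r)%qT - r \is a Num.int.
  by rewrite -[_ \is a _]/(_ \in integers) Quotient.idealrBE reprK.
by rewrite -[repr _](subrK r) e addrC distZDz.
Qed.

Lemma norm_RmodZ_ge0 x : 0 <= norm_RmodZ x. Proof. exact: distZ_ge0. Qed.
Lemma norm_RmodZ0 : norm_RmodZ 0 = 0.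
Proof. by rewrite -(raddf0 (\pi_RmodZ)%qT) norm_pi distZ0. Qed.
Lemma norm_RmodZN x : norm_RmodZ (- x) = norm_RmodZ x.
Proof. by rewrite -[x]reprK -raddfN !norm_pi distZN. Qed.
Lemma norm_RmodZD x y : norm_RmodZ (x + y) <= norm_RmodZ x + norm_RmodZ y.
Proof. by rewrite -[x]reprK -[y]reprK -raddfD !norm_pi distZD. Qed.

Variable lambda : {posnum R}.

Definition U1_tol k (x y : {ffun 'I_k -> RmodZ}) : Prop :=
  \sum_(i < k) norm_RmodZ (x i - y i) <= lambda%:num.

Lemma U1_tolE k (x y : {ffun 'I_k -> RmodZ}) :
  U1_tol x y = (\sum_(i < k) norm_RmodZ ((x - y) i) <= lambda%:num).
Proof.
by congr (is_true (_ <= _)); apply: eq_bigr => i _; rewrite !ffunE.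
Qed.

Lemma U1_tolN k (x y : {ffun 'I_k -> RmodZ}) : U1_tol x y -> U1_tol (- x) (- y).
Proof.
rewrite !U1_tolE -opprD; under [X in _ -> X <= _]eq_bigr do rewrite ffunE norm_RmodZN.
by [].
Qed.

Definition U1_tmod : TolSmodule.
Proof.
refine (@Tmod (H RmodZ) U1_tol _ _ _).
- move=> k x; rewrite /U1_tol big1 // => i _; by rewrite subrr norm_RmodZ0.
- move=> k x y; rewrite /U1_tol; congr (_ <= _).
  by apply: eq_bigr => i _; rewrite -norm_RmodZN opprB.
- move=> k l f x y; rewrite !U1_tolE /= -raddfB.
  apply: le_trans; apply: Hmap_norm_le.
  + exact: norm_RmodZ0.
  + exact: norm_RmodZ_ge0.
  + exact: norm_RmodZD.
Defined.

Definition U1 : TolSignedSmodule.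
Proof.
refine (@Tspmod U1_tmod (H_sign RmodZ) _).
by move=> [] // k x y; exact: U1_tolN.
Defined.

End U1.

Section Cohomology.
Variables (R : realType) (D : arakelov R).

Definition HO k : set {ffun 'I_k -> adele R} :=
  [set b | (forall i, Ofin D (b i).1) /\ \sum_(i < k) `|(b i).2| <= expR D.2].

Definition H0_mem k : set {ffun 'I_k -> rat} :=
  [set q | (forall i, Ofin D (finite_diag (q i))) /\
           \sum_(i < k) `|ratr (q i) : R| <= expR D.2].

Lemma HO0 k : HO (0 : {ffun 'I_k -> adele R}).
Proof.
split=> [i|]; first by rewrite ffunE; exact: Ofin0.
by rewrite big1 ?expR_ge0 // => i _; rewrite ffunE normr0.
Qed.
Lemma HON k (b : {ffun 'I_k -> adele R}) : HO b -> HO (- b).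
Proof.
move=> [b1 b2]; split=> [i|]; first by rewrite ffunE; exact/OfinN/b1.
by under eq_bigr do rewrite ffunE normrN.
Qed.
Lemma HO_map k l (f : gmap k l) (b : {ffun 'I_k -> adele R}) : HO b -> HO (Hmap f b).
Proof.
move=> [b1 b2]; split=> [j|].
  rewrite ffunE (raddf_sum (@fst _ _)); exact: Ofin_sum.
apply: le_trans b2.
apply: (@Hmap_norm_le _ R (fun a : adele R => `|a.2|)) => [|//|a c].
  by rewrite normr0.
exact: ler_normD.
Qed.

(* H0_mem is the projection to Q^k of the kernel of (q, b) |-> q + b, which
   determines b. *)
Lemma H0_memE k (q : {ffun 'I_k -> rat}) :
  H0_mem q <-> exists2 b, HO b & forall i, diag R (q i) + b i = 0.
Proof.
split=> [[q1 q2]|[b [b1 b2] qb]].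
  exists [ffun i => - diag R (q i)]; last by move=> i; rewrite ffunE addrN.
  split=> [i|]; first by rewrite ffunE; exact/OfinN/q1.
  by under eq_bigr do rewrite ffunE normrN.
have e i : diag R (q i) = - b i by apply/eqP; rewrite -addr_eq0 qb.
split=> [i|].
  by rewrite -[finite_diag _]/(diag R (q i)).1 e; exact/OfinN/b1.
under eq_bigr => i _ do rewrite -[ratr _]/(diag R (q i)).2 e normrN.
exact: b2.
Qed.

Lemma H0_mem0 k : H0_mem (0 : {ffun 'I_k -> rat}).
Proof. by apply/H0_memE; exists 0; [exact: HO0|move=> i; rewrite !ffunE raddf0 addr0]. Qed.
Lemma H0_memN k (q : {ffun 'I_k -> rat}) : H0_mem q -> H0_mem (- q).
Proof.
move=> /H0_memE[b Hb e]; apply/H0_memE; exists (- b); first exact: HON.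
by move=> i; rewrite !ffunE raddfN -opprD e oppr0.
Qed.
Lemma H0_mem_map k l (f : gmap k l) (q : {ffun 'I_k -> rat}) :
  H0_mem q -> H0_mem (Hmap f q).
Proof.
move=> /H0_memE[b Hb e]; apply/H0_memE; exists (Hmap f b); first exact: HO_map.
move=> j; rewrite !ffunE raddf_sum -big_split /= big1 // => i _; exact: e.
Qed.
Lemma H0_mem_act s k (q : {ffun 'I_k -> rat}) : H0_mem q -> H0_mem (Hact s q).
Proof. by case: s => //; exact: H0_memN. Qed.

Definition H0_smod : Smodule.
Proof.
refine (@Smod (fun k => {q : {ffun 'I_k -> rat} | H0_mem q})
  (fun k => exist _ 0 (H0_mem0 k))
  (fun k l f q => exist _ (Hmap f (sval q)) (H0_mem_map f (svalP q))) _ _ _ _).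
- by move=> k l f; apply: eq_exist; exact: raddf0.
- by move=> k [q Hq]; apply: eq_exist; exact: Hmap_id.
- by move=> k l m g f q; apply: eq_exist; exact: Hmap_comp.
- by move=> [q Hq]; apply: eq_exist; exact: ffun_ord0.
Defined.

Definition H0 : SignedSmodule.
Proof.
refine (@Spmod H0_smod (@SignAction H0_smod
  (fun s k q => exist _ (Hact s (sval q)) (H0_mem_act s (svalP q))) _ _ _ _)).
- by move=> s k; apply: eq_exist; exact: Hact0.
- by move=> s k l f q; apply: eq_exist; exact: Hact_nat.
- by move=> k [q Hq]; apply: eq_exist.
- by move=> s t k q; apply: eq_exist; exact: HactM.
Defined.

Definition H1_tol k (x y : {ffun 'I_k -> adele R}) : Prop :=
  exists (q : {ffun 'I_k -> rat}) (b : {ffun 'I_k -> adele R}),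
    HO b /\ x - y = [ffun i => diag R (q i)] + b.

Lemma H1_tolN k (x y : {ffun 'I_k -> adele R}) : H1_tol x y -> H1_tol (- x) (- y).
Proof.
move=> [q [b [Hb e]]]; exists (- q), (- b); split; first exact: HON.
rewrite -opprD e opprD; congr (_ - _).
by apply/ffunP => i; rewrite !ffunE raddfN.
Qed.

Definition H1_tmod : TolSmodule.
Proof.
refine (@Tmod (H (adele R)) H1_tol _ _ _).
- move=> k x; exists 0, 0; split; first exact: HO0.
  by rewrite subrr addr0; apply/ffunP => i; rewrite !ffunE raddf0.
- move=> k x y /H1_tolN[q [b [Hb e]]]; exists q, b; split=> //.
  by rewrite -e opprK addrC.
- move=> k l f x y [q [b [Hb e]]]; exists (Hmap f q), (Hmap f b).
  split; first exact: HO_map.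
  rewrite -[LHS](raddfB (Hmap f)) e raddfD; congr (_ + _).
  apply/ffunP => j; rewrite !ffunE raddf_sum.
  by apply: eq_bigr => i _; rewrite ffunE.
Defined.

Definition H1 : TolSignedSmodule.
Proof.
refine (@Tspmod H1_tmod (H_sign (adele R)) _).
by move=> [] // k x y; exact: H1_tolN.
Defined.

(* The subgroup Q + O(D)_f of A_Q, with O(D)_f at archimedean component 0. *)
Definition QOfin : set (adele R) :=
  [set x | exists (q : rat) (b : finite_adele), Ofin D b /\ x = diag R q + (b, 0)].

End Cohomology.

Definition prime2 : primeT := exist _ 2%N (isT : prime 2).

Definition canonical_divisor (R : realType) : arakelov R := (<< (-2) *g prime2 >>, 0).

(* Main.v *)
From HB Require Import structures.
Require Import Defs.
From mathcomp Require Import all_boot all_order all_algebra.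
From mathcomp Require Import all_classical all_reals all_analysis.
From mathcomp Require Import fraction freeg ring lra.
Set Implicit Arguments.
Unset Strict Implicit.
Unset Printing Implicit Defensive.
Import Order.TTheory GRing.Theory Num.Theory.
Local Open Scope classical_set_scope.
Local Open Scope ring_scope.

(** Write g for the product of the p ^ (- d_p), where d_p is the multiplicity of
    p in D, and a for the coefficient of D at infinity.  By strong approximation
    every adele is x = q + b + t with q rational, b in O(D)_f and t real
    ([strong_approximation], [adele_decomp]), and t is unique up to the group of
    rationals that lie in O(D)_f, namely Z g.  Hence every real c with c g
    integral defines a character x |-> c t mod Z of the adeles, trivial on Q and
    on O(D)_f ([adele_char]).  These frequencies c are the numbers q / 4 where q
    is a rational in O(K - D)_f ([dual_of_Ofin], [Ofin_of_dual]); the 2-adic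
    valuation 2 that K = -2{2} imposes is the factor 4, which is needed because
    the radius of the tolerance is 1/4.  A tuple (q_i) in H^0(K - D) thus gives
    the tuple of characters of frequencies q_i / 4, and
      sum_ij |q_i t_j / 4| <= (sum_i |q_i|) (sum_j |t_j|) / 4 <= e^(-a) e^a / 4
    says that these characters are tolerant ([char_mx_tol]).

    Conversely, naturality alone shows that a morphism HA -> HB(k_+ /\ -)
    consists of k additive maps A -> B ([natural_matrix]).  For a tolerant
    morphism they are characters chi_i with sum_ij |chi_i(x_j)| <= 1/4 as soon as
    x is in Q^n + HO(D)(n_+).  The ball of radius 1/4 of the circle contains no
    subgroup but 0 ([small_multiples_eq0]), so each chi_i vanishes on Q + O(D)_f.
    For the same reason its restriction to the real line is t |-> c_i t, although
    no continuity is assumed ([real_character]).  Testing the bound on the pair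
    of real adeles (e^a / 2, e^a / 2) gives sum_i |c_i| <= e^(-a) / 4, so that
    the tuple (4 c_i) lies in H^0(K - D) ([duality_surj]).

    For D = K the number 1/4 is a frequency, and its character identifies
    A_Q / (Q + O(K)_f) with R/Z; the tolerance relations agree because each point
    of the circle has a lift whose absolute value is its norm
    ([quarter_map_tol]). *)

(** * Arithmetic of p-adic integers and numbers *)

Section PadicIntegers.
Variable p : primeT.
Local Notation P n := ((p ^ n)%N%:Z).
Implicit Types x y z : padic_int p.

Lemma P_gt0 n : 0 < P n :> int.
Proof. by rewrite ltz_nat expn_gt0 prime_gt0 ?primeTP. Qed.

Lemma P_neq0 n : P n != 0.
Proof. by rewrite gt_eqF ?P_gt0. Qed.

Lemma padic_natrX n : (p%:R : padic_int p) ^+ n = (P n)%:~R.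
Proof. by rewrite -natrX. Qed.

(** The quotient has the shifted residues x (k + n) / p ^ n. *)
Lemma padic_divide x n : x n = 0 -> exists z, x = p%:R ^+ n * z.
Proof.
move=> xn0.
have dv k : (P n %| x (k + n)%N)%Z.
  by apply/dvdz_mod0P; rewrite -zp_low ?leq_addl.
have Hf : mod_coherent p (fun k => (x (k + n)%N %/ P n)%Z).
  move=> k; apply/eqP; rewrite eqz_mod_dvd.
  rewrite -(@dvdz_mul2r (P n)) ?P_neq0//.
  rewrite mulrBl !divzK// -PoszM -expnD -eqz_mod_dvd addSn.
  by rewrite [x (k + n)%N]zpP modz_mod.
exists (mk_padic Hf); apply: padic_ext => k.
rewrite padic_natrX padicME padic_intrE /= modzMm mulrC divzK//.
by rewrite -(@zp_low p x) ?leq_addr.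
Qed.

(** A Bezout inverse modulo each p ^ n; inverses being unique, these are
    coherent. *)
Lemma padic_unit x : x 1%N != 0 -> exists y, y * x = 1.
Proof.
move=> x1.
have cop n : coprimez (x n.+1) (P n).
  rewrite coprimezE /= coprime_sym; apply: coprimeXl.
  rewrite prime_coprime ?primeTP//; apply: contra x1 => dv.
  have : (P 1 %| x n.+1)%Z by rewrite expn1.
  by move=> /dvdz_mod0P; rewrite -zp_low// => ->.
pose u n := (egcdz (x n.+1) (P n)).1.
have uP n : (u n * x n.+1 = 1 %[mod P n])%Z.
  rewrite /u; case: egcdzP => v w /= e _; move: (cop n) => /eqP g1.
  by rewrite g1 in e; rewrite -e addrC modzMDl.
have Hf : mod_coherent p u.
  move=> n; have e1 := uP n.
  have dv : (P n %| P n.+1)%Z by apply: dvdn_exp2l.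
  have e2 : (u n.+1 * x n.+1 = 1 %[mod P n])%Z.
    by rewrite [x n.+1]zpP -[LHS](modz_dvdm _ dv) modzMmr uP modz_dvdm.
  apply/eqP; rewrite eqz_mod_dvd -(Gauss_dvdzr _ (m := P n) (n := x n.+1)).
    by rewrite mulrBr -eqz_mod_dvd ![x n.+1 * _]mulrC e1 e2.
  by rewrite coprimez_sym.
exists (mk_padic Hf); apply: padic_ext => n.
by rewrite padic1E padicME /= modzMml -(uP n) [x n]zpP modzMmr.
Qed.

(** Z_p is a discrete valuation ring: n is the largest index where the residue
    vanishes. *)
Lemma padic_decomp x : x != 0 ->
  exists n u v, x = p%:R ^+ n * u /\ v * u = 1.
Proof.
move=> x0.
have nz : exists n, x n != 0.
  apply: contrapT => H; case/eqP: x0; apply: padic_ext => n; rewrite padic0E.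
  by apply/eqP; apply: contrapT => /negP nd; apply: H; exists n.
have [[|n] xn mn] := find_ex_minn nz.
  by rewrite -residueK expn0 modz1 eqxx in xn.
have xn0 : x n = 0.
  by apply/eqP; apply: contrapT => /negP /mn; rewrite ltnn.
have [u xu] := padic_divide xn0.
suff /padic_unit[v vu] : u 1%N != 0 by exists n, u, v.
apply: contra xn => /eqP /padic_divide[w uw].
by rewrite xu uw expr1 mulrA -exprSr padic_natrX padicME padic_intrE modzz mul0r mod0z.
Qed.

Lemma padic_approx x n : exists a z, x = a%:~R + p%:R ^+ n * z.
Proof.
have /padic_divide[z e] : (x - (x n)%:~R) n = 0.
  by rewrite padicDE padicNE padic_intrE modzDmr residueK subrr mod0z.
by exists (x n), z; rewrite -e addrC subrK.
Qed.

End PadicIntegers.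

Section PadicNumbers.
Variable p : primeT.

Lemma Qp_p_neq0 : (p%:R : Qp p) != 0.
Proof. by rewrite -[p%:R]/((p%:Z)%:~R) Qp_intr_eq0 -lt0n prime_gt0 ?primeTP. Qed.

Lemma ratr_Qp_nat (n : nat) : ratr n%:R = n%:R :> Qp p.
Proof.
have := @ratr_Qp_frac p n 1 (oner_neq0 _).
by rewrite !divr1.
Qed.

(** Numerators and denominators multiply only up to a common factor, which
    cancels because Q_p has characteristic zero. *)
Lemma ratr_QpM (x y : rat) : ratr (x * y) = ratr x * ratr y :> Qp p.
Proof.
rewrite -(divq_num_den x) -(divq_num_den y).
rewrite mulf_div -!intrM !ratr_Qp_frac ?mulf_neq0 ?denq_neq0//.
by rewrite mulf_div -!intrM.
Qed.

Lemma ratr_Qp1 : ratr 1 = 1 :> Qp p.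
Proof. exact: (ratr_Qp_nat 1). Qed.

Lemma ratr_QpD (x y : rat) : ratr (x + y) = ratr x + ratr y :> Qp p.
Proof. by rewrite -[LHS]/(finite_diag (x + y) p) raddfD. Qed.

Lemma ratr_Qp_neq0 (x : rat) : x != 0 -> (ratr x : Qp p) != 0.
Proof.
move=> x0; apply/eqP => e; move: (ratr_QpM x x^-1).
by rewrite mulfV// e mul0r ratr_Qp1 => /eqP; rewrite oner_eq0.
Qed.

Lemma ratr_QpV (x : rat) : ratr x^-1 = (ratr x)^-1 :> Qp p.
Proof.
have [->|x0] := eqVneq x 0.
  by rewrite invr0 -[ratr 0]/(finite_diag 0 p) raddf0 invr0.
apply: (mulIf (ratr_Qp_neq0 x0)).
by rewrite mulVf ?ratr_Qp_neq0// -ratr_QpM mulVf// ratr_Qp1.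
Qed.

Lemma ratr_QpX (x : rat) (n : nat) : ratr (x ^+ n) = ratr x ^+ n :> Qp p.
Proof. by elim: n => [|n IH]; rewrite ?expr0 ?ratr_Qp1// !exprS ratr_QpM IH. Qed.

Lemma ratr_QpXz (x : rat) (m : int) : ratr (x ^ m) = ratr x ^ m :> Qp p.
Proof. by case: m => n; rewrite -?exprnP -?exprnN ?ratr_QpX// NegzE -!exprnN ratr_QpV ratr_QpX. Qed.

Lemma pZpM m n (x y : Qp p) : pZp m x -> pZp n y -> pZp (m + n) (x * y).
Proof.
move=> [z ->] [t ->]; exists (z * t).
by rewrite tofracM mulrACA expfzDr// Qp_p_neq0.
Qed.

Lemma pZp_expz m : pZp m (ratr (p%:R ^ m) : Qp p).
Proof. by exists 1; rewrite tofrac1 mulr1 ratr_QpXz ratr_Qp_nat. Qed.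

Lemma pZp_int (a : int) : pZp 0 (ratr a%:~R : Qp p).
Proof. by apply: pZp_ratr; rewrite denq_int /= dvdn1 neq_ltn prime_gt1 ?primeTP ?orbT. Qed.

Lemma tofrac_p : tofrac p%:R = p%:R :> Qp p.
Proof. by rewrite rmorph_nat. Qed.

Lemma pZp_le m n (x : Qp p) : m <= n -> pZp n x -> pZp m x.
Proof.
rewrite -subr_ge0 => + [z ->].
case e : (n - m) => [k|//] _; exists (p%:R ^+ k * z).
rewrite tofracM tofracXn tofrac_p.
by rewrite mulrA exprnP -e -expfzDr ?Qp_p_neq0// addrC subrK.
Qed.

Lemma Qp_frac (y : Qp p) :
  exists2 zw : padic_int p * padic_int p, zw.2 != 0 & y = tofrac zw.1 / tofrac zw.2.
Proof.
set r := repr y.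
exists (frac r); first exact: denom_ratioP.
have d0 : tofrac (frac r).2 != 0 :> Qp p by rewrite tofrac_eq0 denom_ratioP.
apply: (canRL (mulfK d0)); rewrite -{1}[y]reprK -/r.
unlock FracField.tofrac; rewrite -[LHS]FracField.pi_mul.
apply/eqmodP => /=; rewrite /FracField.equivf /FracField.mulf.
by rewrite !numden_Ratio ?(oner_neq0, mulr1, mulf_neq0, denom_ratioP)// mulrC.
Qed.

(** Density of Z[1/p] in Q_p.  If y = t / p ^ n with t in Z_p, then a is an
    integer close to t. *)
Lemma Qp_approx (y : Qp p) (m : int) :
  exists (a : int) (n : nat), pZp m (y - ratr (a%:~R / p%:R ^+ n)).
Proof.
have [[z w] /= w0 ->] := Qp_frac y.
have [n [u [v [ew vu]]]] := padic_decomp w0.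
(* The precision n + |m| leaves |m| >= m after the division by p ^ n. *)
have [a [b zv]] := padic_approx (z * v) (n + `|m|)%N.
exists a, n; apply: (@pZp_le _ `|m|%N); first by rewrite abszE ler_norm.
have tu : tofrac v * tofrac u = 1 :> Qp p by rewrite -tofracM vu tofrac1.
have u0 : (tofrac u : Qp p) != 0.
  by apply/eqP => e; move: tu; rewrite e mulr0 => /eqP; rewrite eq_sym oner_eq0.
have p0 := expf_neq0 n Qp_p_neq0.
exists b; rewrite ratr_QpM ratr_QpV ratr_QpX ratr_Qp_nat.
have -> : ratr a%:~R = tofrac a%:~R :> Qp p.
  by rewrite rmorph_int -[a%:~R]divr1 -[1 in LHS]/(1%:~R) ratr_Qp_frac ?divr1.
rewrite ew tofracM tofracXn tofrac_p.
have -> : tofrac z / (p%:R ^+ n * tofrac u) = tofrac (z * v) / p%:R ^+ n :> Qp p.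
  have uV : (tofrac u)^-1 = tofrac v :> Qp p by apply: (mulIf u0); rewrite tu mulVf.
  by rewrite tofracM invfM uV mulrA mulrAC.
rewrite -mulrBl zv tofracD addrC addKr tofracM tofracXn tofrac_p.
by rewrite exprD mulrAC [p%:R ^+ n * _]mulrC mulfK// exprnP.
Qed.

Lemma denq_pZp (s : rat) : pZp 0 (ratr s : Qp p) -> ~~ (p %| `|denq s|)%N.
Proof.
move=> [z]; rewrite expr0z mul1r => e; apply/negP => pd.
have d0 : ((denq s)%:~R : Qp p) != 0 by rewrite Qp_intr_eq0 denq_neq0.
have {}e : (numq s)%:~R = z * (denq s)%:~R :> padic_int p.
  apply/eqP; rewrite -(@tofrac_eq (padic_int p)) tofracM !rmorph_int -e.
  by rewrite -[in ratr s](divq_num_den s) ratr_Qp_frac ?denq_neq0// divfK.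
have : (p %| `|numq s|)%N.
  have := congr1 (fun x : padic_int p => x 1%N) e.
  rewrite padicME !padic_intrE modzMmr expn1.
  have /dvdz_mod0P -> : (p%:Z %| z 1%N * denq s)%Z by apply: dvdz_mull; exact: pd.
  by move=> /dvdz_mod0P.
move=> pn; have := coprime_num_den s.
rewrite /coprime => /eqP g; have := dvdn_gcd p `|numq s| `|denq s|.
by rewrite g pn pd dvdn1 gtn_eqF ?prime_gt1 ?primeTP.
Qed.

End PadicNumbers.

(** * Strong approximation and the duality between D and K - D *)

Lemma pZp_intV (p : primeT) (a : int) :
  ~~ (p %| `|a|)%N -> pZp 0 (ratr (a%:~R)^-1 : Qp p).
Proof.
move=> pa.
have [z za] : exists z, z * a%:~R = 1 :> padic_int p.
  apply: padic_unit; rewrite padic_intrE expn1.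
  by apply: contra pa => /eqP/dvdz_mod0P.
exists z; rewrite expr0z mul1r -[a%:~R^-1]mul1r.
have a0 : a != 0 by apply: contraNneq pa => ->; rewrite dvdn0.
rewrite -[1]/(1%:~R : rat) ratr_Qp_frac//.
apply: (canLR (mulfK _)); first by rewrite Qp_intr_eq0.
by rewrite -(rmorph_int (@tofrac (padic_int p)) a) -tofracM za tofrac1.
Qed.

Lemma pZp_other_prime (p p' : primeT) (m : int) :
  p != p' -> pZp 0 (ratr (p'%:R ^ m) : Qp p).
Proof.
move=> pp'; case: m => n.
  by rewrite -exprnP -[p'%:R]/((p'%:Z)%:~R) -rmorphXn; exact: pZp_int.
rewrite NegzE -exprnN -[p'%:R]/((p'%:Z)%:~R) -rmorphXn; apply: pZp_intV.
rewrite abszX Euclid_dvdX ?primeTP// andbT.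
by rewrite dvdn_prime2 ?primeTP.
Qed.

Lemma pZp_prod_primes (p : primeT) (f : primeT -> int) (L : seq primeT) :
  uniq L ->
  pZp (if p \in L then f p else 0) (ratr (\prod_(r <- L) (r%:R : rat) ^ f r) : Qp p).
Proof.
elim: L => [_|r L IH /= /andP[rL /IH{}IH]].
  rewrite big_nil; exact: (pZp_int p 1).
rewrite big_cons ratr_QpM in_cons.
move: IH; have [->|pr] /= := eqVneq p r => IH.
  rewrite -[X in pZp X]addr0; apply: pZpM; first exact: pZp_expz.
  by rewrite (negbTE rL) in IH.
by rewrite -[X in pZp X]add0r; apply: pZpM => //; exact: pZp_other_prime.
Qed.

Lemma prod_primes_neq0 (f : primeT -> int) (L : seq primeT) :
  \prod_(r <- L) (r%:R : rat) ^ f r != 0.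
Proof.
elim: L => [|r s IH]; first by rewrite big_nil.
by rewrite big_cons mulf_neq0// expfz_neq0// pnatr_eq0 -lt0n prime_gt0 ?primeTP.
Qed.

(** Strong approximation at finitely many places, one prime p at a time.  The
    correction N * s of the previous approximation q has s in Z[1/p], hence
    integral at the other primes, and N so divisible by the primes already
    treated that q stays good there; N being nonzero, s can be chosen to make the
    approximation good at p. *)
Lemma rat_approx_seq (x : forall p : primeT, Qp p) (m : primeT -> int) (L : seq primeT) :
  uniq L -> exists q : rat,
    (forall p, p \in L -> pZp (m p) (x p - ratr q)) /\
    (forall p, p \notin L -> pZp 0 (ratr q : Qp p)).
Proof.
elim: L => [_|p L IH /= /andP[pL uL]].
  by exists 0; split=> // p _; rewrite -[ratr 0]/(finite_diag 0 p) raddf0; exact: pZp_0.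
have [q [qL qnL]] := IH uL.
pose f (r : primeT) : int := `|m r|%N.
set N : rat := \prod_(r <- L) (r%:R : rat) ^ f r.
have N0 : (ratr N : Qp p) != 0 by rewrite ratr_Qp_neq0 ?prod_primes_neq0.
have [a [n sP]] := Qp_approx ((x p - ratr q) / ratr N) (m p).
set s : rat := a%:~R / p%:R ^+ n in sP.
have s0 r : r != p -> pZp 0 (ratr s : Qp r).
  move=> rp; rewrite /s ratr_QpM -[0]addr0; apply: pZpM; first exact: pZp_int.
  by rewrite exprnN; exact: pZp_other_prime.
have NL r := pZp_prod_primes r f uL.
exists (q + N * s); split=> r; rewrite in_cons ?negb_or.
  have [-> _|rp /= rL] := eqVneq r p.
    have -> : x p - ratr (q + N * s) = ratr N * ((x p - ratr q) / ratr N - ratr s).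
      by rewrite ratr_QpD ratr_QpM mulrBr [ratr N * (_ / ratr N)]mulrC divfK// opprD addrA.
    rewrite -[m p]add0r; apply: pZpM => //.
    by have := NL p; rewrite (negbTE pL).
  rewrite ratr_QpD opprD addrA; apply: pZpD; first exact: qL.
  apply: pZpN; apply: (@pZp_le _ _ (f r + 0)); first by rewrite addr0 /f abszE ler_norm.
  rewrite ratr_QpM; apply: pZpM; last exact: s0.
  by have := NL r; rewrite rL.
move=> /andP[rp rL]; rewrite ratr_QpD; apply: pZpD; first exact: qnL.
rewrite ratr_QpM -[0]addr0; apply: pZpM; last exact: s0.
by have := NL r; rewrite (negbTE rL).
Qed.

Section Arakelov.
Variables (R : realType) (D : arakelov R).

(** Only the primes that occur in D or where x is not integral matter; at any
    other prime both x and the approximation are in Z_p. *)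
Lemma strong_approximation (x : finite_adele) :
  exists q : rat, Ofin D (x - finite_diag q).
Proof.
have /finite_seqP[s xs] := faP x.
pose L := undup (s ++ (dom D.1 : seq primeT)).
have [q [qL qnL]] := rat_approx_seq x (fun p => - coeff p D.1) (undup_uniq (s ++ dom D.1)).
exists q => p; rewrite faDE faNE.
have [|pL] := boolP (p \in L); first exact: qL.
have := qnL _ pL; move: pL; rewrite mem_undup mem_cat negb_or => /andP[ps pd] q0.
rewrite coeff_outdom// oppr0; apply: pZpD; last exact: pZpN.
apply: contrapT => /= xp; move/negP: ps; apply.
by have : [set` s] p by rewrite -xs.
Qed.

(** A generator of the group of rationals that lie in O(E)_f. *)
Definition generator (E : arakelov R) : rat :=
  \prod_(p <- (dom E.1 : seq primeT)) (p%:R : rat) ^ (- coeff p E.1).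

Lemma Ofin_generator E : Ofin E (finite_diag (generator E)).
Proof.
move=> p.
have := pZp_prod_primes p (fun p => - coeff p E.1) (uniq_dom E.1).
by case: ifPn => // /coeff_outdom ->.
Qed.

Lemma generator_neq0 E : generator E != 0.
Proof. exact: prod_primes_neq0. Qed.

Lemma pZp_generatorV E (p : primeT) :
  pZp (coeff p E.1) (ratr (generator E)^-1 : Qp p).
Proof.
have := pZp_prod_primes p (fun p => coeff p E.1) (uniq_dom E.1).
rewrite /generator -prodfV; under [in X in _ -> X]eq_bigr do rewrite invr_expz opprK.
by case: ifPn => // /coeff_outdom ->.
Qed.

End Arakelov.

(** Q meets the product of the Z_p in Z: a prime factor of the denominator would
    divide the numerator. *)
Lemma rat_int_of_local (s : rat) :
  (forall p : primeT, pZp 0 (ratr s : Qp p)) -> s \is a Num.int.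
Proof.
move=> sP; rewrite Qint_def; apply/eqP.
have d1 : `|denq s|%N = 1%N.
  apply/eqP; apply: contrapT => /negP d1.
  have pr : prime (pdiv `|denq s|).
    by apply: pdiv_prime; rewrite ltn_neqAle eq_sym d1 absz_gt0 denq_neq0.
  by have := denq_pZp (sP (exist _ (pdiv `|denq s|) pr : primeT)); rewrite /= pdiv_dvd.
by rewrite -absz_denq d1.
Qed.

Section Duality.
Variables (R : realType) (D : arakelov R).
Local Notation K := (canonical_divisor R).

Lemma coeff_canonical (p : primeT) : coeff p K.1 = if p == prime2 then -2 else 0.
Proof. by rewrite coeffU eq_sym; case: eqP; rewrite ?mulr1 ?mulr0. Qed.

Lemma pZp_four (p : primeT) : pZp (- coeff p K.1) (ratr 4 : Qp p).
Proof.
have -> : 4 = (2%:R : rat) ^ 2%Z by rewrite -exprnP -natrX.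
rewrite coeff_canonical; case: eqVneq => [->|p2]; first exact: (@pZp_expz prime2 2).
by rewrite oppr0; exact: (@pZp_other_prime p prime2).
Qed.

Lemma pZp_fourV (p : primeT) : pZp (coeff p K.1) (ratr 4^-1 : Qp p).
Proof.
have -> : 4^-1 = (2%:R : rat) ^ (- 2%N%:Z) by rewrite -exprnN -natrX.
rewrite coeff_canonical; case: eqVneq => [->|p2]; first exact: (@pZp_expz prime2 (- 2)).
exact: (@pZp_other_prime p prime2).
Qed.

(** The real c for which t |-> c t mod Z factors through the quotient of R by
    the rationals in O(D)_f. *)
Definition dual_frequency (c : R) : Prop :=
  forall r : rat, Ofin D (finite_diag r) -> c * ratr r \is a Num.int.

(** The product of rationals in O(K - D)_f and O(D)_f is in O(K)_f, hence a
    multiple of 4. *)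
Lemma dual_of_Ofin (q : rat) :
  Ofin (K - D) (finite_diag q) -> dual_frequency (ratr (q / 4)).
Proof.
move=> qP r rD; rewrite -rmorphM.
have /intrP[n ->] : q / 4 * r \is a Num.int.
  apply: rat_int_of_local => p.
  have -> : 0 = - coeff p (K - D).1 + coeff p K.1 + - coeff p D.1.
    by rewrite coeffB; ring.
  rewrite (ratr_QpM p (q / 4)) (ratr_QpM p q).
  apply: pZpM; last exact: rD.
  by apply: pZpM; [exact: qP|exact: pZp_fourV].
by rewrite /= ratr_int.
Qed.

(** If g is the generator for D, then c = n / g for an integer n, and q is
    4 n / g. *)
Lemma Ofin_of_dual (c : R) : dual_frequency c ->
  exists2 q : rat, Ofin (K - D) (finite_diag q) & c = ratr (q / 4).
Proof.
move=> /(_ _ (Ofin_generator D))/intrP[n cn].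
exists (n%:~R * 4 * (generator D)^-1).
  move=> p; rewrite /= (ratr_QpM p (_ * 4)) (ratr_QpM p _ 4).
  have -> : - coeff p (K - D).1 = 0 + - coeff p K.1 + coeff p D.1.
    by rewrite coeffB; ring.
  apply: pZpM; last exact: pZp_generatorV.
  by apply: pZpM; [exact: pZp_int|exact: pZp_four].
have g0 : (ratr (generator D) : R) != 0 by rewrite fmorph_eq0 generator_neq0.
apply: (mulIf g0); rewrite cn -rmorphM -[LHS](ratr_int R); congr ratr.
by field; rewrite generator_neq0.
Qed.

Definition rational_part (x : finite_adele) : rat :=
  sval (cid (strong_approximation D x)).

Lemma rational_partP x : Ofin D (x - finite_diag (rational_part x)).
Proof. by rewrite /rational_part; case: cid. Qed.

(** The real coordinate t of one chosen decomposition x = q + b + t with q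
    rational and b in O(D)_f; [archP] measures its dependence on the choice. *)
Definition arch (x : adele R) : R := x.2 - ratr (rational_part x.1).

Lemma archP (x : adele R) (q : rat) (b : finite_adele) : Ofin D b ->
  x.1 = finite_diag q + b ->
  exists2 r : rat, Ofin D (finite_diag r) & arch x = x.2 - ratr q + ratr r.
Proof.
move=> bD xE; exists (q - rational_part x.1); last first.
  by rewrite /arch rmorphB addrA subrK.
rewrite raddfB /=; have -> : finite_diag q = x.1 - b by rewrite xE addrK.
by rewrite addrAC; apply: OfinD; [exact: rational_partP|exact: OfinN].
Qed.

Lemma archD (x y : adele R) :
  exists2 r : rat, Ofin D (finite_diag r) & arch (x + y) = arch x + arch y + ratr r.
Proof.
have [||r rD ->] := @archP (x + y) (rational_part x.1 + rational_part y.1)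
  ((x.1 - finite_diag (rational_part x.1)) + (y.1 - finite_diag (rational_part y.1))).
- by apply: OfinD; exact: rational_partP.
- by rewrite (raddfD finite_diag) /= addrACA !subrKC.
by exists r => //; rewrite /arch rmorphD opprD addrACA.
Qed.

End Duality.

(** * The circle *)

Section Circle.
Variable R : realType.
Implicit Types (r s : R) (x y : RmodZ R).

Definition toRZ (r : R) : RmodZ R := (\pi_(RmodZ R) r)%qT.

Lemma toRZ_is_zmod_morphism : zmod_morphism toRZ.
Proof. by move=> r s; rewrite /toRZ raddfB. Qed.
HB.instance Definition _ :=
  GRing.isZmodMorphism.Build R (RmodZ R) toRZ toRZ_is_zmod_morphism.

Lemma toRZ_eq0 r : toRZ r = 0 <-> r \is a Num.int.
Proof.
rewrite -(raddf0 toRZ); suff e : (toRZ r == toRZ 0) = (r \is a Num.int).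
  by split=> [/eqP|]; rewrite -e => // /eqP.
by rewrite -[in RHS](subr0 r) -[RHS]/(r - 0 \in integers (R := R)) Quotient.idealrBE.
Qed.

(** The nonzero integers are at distance at least 1 - |r| >= |r| from r. *)
Lemma norm_toRZ r : `|r| <= 2^-1 -> norm_RmodZ (toRZ r) = `|r|.
Proof.
move=> r2; rewrite norm_pi; apply/eqP; rewrite eq_le; apply/andP; split.
  by apply: le_trans (distZ_le r 0) _; rewrite subr0.
apply: distZ_glb => n; have [->|n0] := eqVneq n 0; first by rewrite subr0.
have : 1 <= `|n%:~R| :> R by rewrite -intr_norm (ler_int _ 1) -gtz0_ge1 normr_gt0.
have := lerB_dist n%:~R r; rewrite distrC; lra.
Qed.

(** The infimum that defines the norm is attained, at the lift nearest to 0. *)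
Lemma norm_RmodZ_lift x : exists2 r, toRZ r = x & norm_RmodZ x = `|r|.
Proof.
pose n := Num.floor (repr x + 2^-1).
have e : toRZ (repr x - n%:~R) = x.
  by rewrite raddfB /= (proj2 (toRZ_eq0 n%:~R)) ?intr_int// subr0 /toRZ reprK.
exists (repr x - n%:~R) => //; rewrite -{1}e norm_toRZ//.
have := floor_le (repr x + 2^-1); have := floorD1_gt (repr x + 2^-1).
rewrite -/n intrD ler_norml => *; apply/andP; split; lra.
Qed.

Lemma norm_RmodZ_eq0 x : norm_RmodZ x = 0 -> x = 0.
Proof.
have [r <- ->] := norm_RmodZ_lift x.
by move=> /normr0_eq0 ->; rewrite raddf0.
Qed.

Lemma norm_RmodZ_double x : norm_RmodZ x <= 4^-1 ->
  norm_RmodZ (x + x) = 2 * norm_RmodZ x.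
Proof.
have [r <- ->] := norm_RmodZ_lift x => r4.
have rr : `|r + r| = 2 * `|r| by rewrite -normr_nat -normrM; congr `|_|; ring.
by rewrite -raddfD norm_toRZ rr//; lra.
Qed.

(** The circle has no small subgroups: within radius 1/4 doubling a point doubles
    its norm, so the multiples by powers of 2 of a nonzero point leave the
    ball. *)
Lemma small_multiples_eq0 x : (forall n, norm_RmodZ (x *+ n) <= 4^-1) -> x = 0.
Proof.
move=> xn; apply: norm_RmodZ_eq0.
have e n : norm_RmodZ (x *+ (2 ^ n)%N) = 2 ^+ n * norm_RmodZ x.
  elim: n => [|n IH]; first by rewrite expr0 mul1r.
  by rewrite expnS mul2n -addnn mulrnDr norm_RmodZ_double// IH mulrA -exprS.
apply: contrapT => /eqP nx0.
have nx : 0 < norm_RmodZ x by rewrite lt0r norm_RmodZ_ge0 andbT.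
have := xn (2 ^ Num.bound (norm_RmodZ x)^-1)%N; rewrite e; apply/negP; rewrite -ltNge.
apply: (@lt_le_trans _ _ 1); first lra.
rewrite -ler_pdivrMr// mul1r.
by apply: ltW; exact: upper_nthrootP.
Qed.

Lemma norm_toRZ_le r : norm_RmodZ (toRZ r) <= `|r|.
Proof. by rewrite norm_pi; have := distZ_le r 0; rewrite subr0. Qed.

Lemma toRZ_mul_eq0 r : (forall t, toRZ (r * t) = 0) -> r = 0.
Proof.
move=> rt; apply: contrapT => /eqP r0.
have := norm_toRZ (r := 2^-1); rewrite -(mulVKf r0 2^-1) rt norm_RmodZ0 mulVKf//.
by rewrite ger0_norm ?invr_ge0// lexx => /(_ isT)/eqP; rewrite eq_sym invr_eq0 pnatr_eq0.
Qed.

(** Automatic continuity.  Let c be the frequency with |c| M <= 1/8 that is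
    correct at M.  Then g t = h t - c t is M-periodic and of norm at most
    1/8 + 1/8 on a period, so its values form a small subgroup.  With the weaker
    hypothesis norm <= 1/4 this estimate would only give 1/2, which is no
    restriction. *)
Lemma real_character (h : {additive R -> RmodZ R}) (M : R) : 0 < M ->
  (forall t, `|t| <= M -> norm_RmodZ (h t) <= 8^-1) ->
  exists2 c, `|c| * M = norm_RmodZ (h M) & forall t, h t = toRZ (c * t).
Proof.
move=> M0 hM; have [r re rn] := norm_RmodZ_lift (h M).
have cM : r / M * M = r by rewrite divfK ?gt_eqF.
exists (r / M).
  by rewrite rn normrM normfV [`|M|]gtr0_norm// divfK ?gt_eqF.
have r8 : `|r| <= 8^-1 by rewrite -rn; apply: hM; rewrite gtr0_norm.
pose g t := h t - toRZ (r / M * t).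
have gD s t : g (s + t) = g s + g t.
  by rewrite /g raddfD mulrDr raddfD opprD addrACA.
have gM : g M = 0 by rewrite /g cM re subrr.
have gn (n : int) : g (n%:~R * M) = 0.
  by rewrite /g mulrCA cM !mulrzl (raddfMz h) (raddfMz toRZ) /= re subrr.
have gs t : norm_RmodZ (g t) <= 4^-1.
  pose n := Num.floor (t / M).
  have -> : t = n%:~R * M + (t - n%:~R * M) by rewrite subrKC.
  rewrite gD gn add0r; set s := t - _.
  have sM : `|s| <= M.
    have := floor_le (t / M); have := floorD1_gt (t / M).
    rewrite -/n intrD ltr_pdivrMr// ler_pdivlMr// mulrDl mul1r /s => *.
    rewrite ler_norml; apply/andP; split; lra.
  apply: le_trans (norm_RmodZD _ _) _; rewrite norm_RmodZN.
  have := hM s sM; have := norm_toRZ_le (r / M * s).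
  have : `|r / M * s| <= `|r|.
    rewrite !normrM normfV [`|M|]gtr0_norm// -mulrA ler_piMr//.
    by rewrite mulrC ler_pdivrMr// mul1r.
  lra.
move=> t; apply/eqP; rewrite -subr_eq0; apply/eqP; rewrite -/(g t).
apply: small_multiples_eq0 => n.
suff -> : g t *+ n = g (t *+ n) by [].
elim: n => [|n IH]; last by rewrite !mulrS gD IH.
by rewrite !mulr0n /g mulr0 (raddf0 h) (raddf0 toRZ) subr0.
Qed.

End Circle.

(** * Characters of the adeles trivial on Q and O(D)_f *)

Section Character.
Variables (R : realType) (D : arakelov R).
Implicit Types (c : R) (x y : adele R).

(** Additive in x when c is a dual frequency; keeping c an arbitrary real
    makes the additivity in c available without side conditions. *)
Definition adele_char (c : R) (x : adele R) : RmodZ R := toRZ (c * arch D x).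

Lemma adele_charE c x (q : rat) (b : finite_adele) : dual_frequency D c ->
  Ofin D b -> x.1 = finite_diag q + b ->
  adele_char c x = toRZ (c * (x.2 - ratr q)).
Proof.
move=> cD bD xE; have [r rD rE] := archP bD xE.
by rewrite /adele_char rE mulrDr raddfD /= (proj2 (toRZ_eq0 (c * ratr r))) ?addr0//; exact: cD.
Qed.

Lemma adele_char_zmod c : dual_frequency D c -> zmod_morphism (adele_char c).
Proof.
move=> cD x y; have [r rD] := archD D (x - y) y; rewrite subrK => e.
rewrite /adele_char -raddfB -mulrBr e addrAC addrK [c * (_ + ratr r)]mulrDr [RHS]raddfD /=.
by rewrite (proj2 (toRZ_eq0 (c * ratr r))) ?addr0//; exact: cD.
Qed.

Lemma adele_charD c d x : adele_char (c + d) x = adele_char c x + adele_char d x.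
Proof. by rewrite /adele_char mulrDl raddfD. Qed.

Lemma adele_charN c x : adele_char (- c) x = - adele_char c x.
Proof. by rewrite /adele_char mulNr raddfN. Qed.

Lemma adele_char0 x : adele_char 0 x = 0.
Proof. by rewrite /adele_char mul0r raddf0. Qed.

Lemma adele_char_real c (t : R) : dual_frequency D c ->
  adele_char c (0, t) = toRZ (c * t).
Proof.
move=> cD; have e : ((0, t) : adele R).1 = finite_diag 0 + 0 by rewrite raddf0 addr0.
by rewrite (adele_charE cD (@Ofin0 R D) e) rmorph0 subr0.
Qed.

Lemma adele_decomp x : exists q b,
  Ofin D b /\ x = diag R q + (b, 0) + (0, arch D x).
Proof.
exists (rational_part D x.1), (x.1 - finite_diag (rational_part D x.1)).
split; first exact: rational_partP.
by case: x => x t; rewrite /arch /diag /=; congr pair; rewrite /= addr0 subrKC.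
Qed.

End Character.

(** * Natural transformations between Eilenberg-Mac Lane modules *)

Section SmashMatrix.
Variables (A : zmodType).

Lemma big_mxvec_index k n (P : pred 'I_(k * n)) (G : 'I_(k * n) -> A) :
  \sum_(c | P c) G c = \sum_(i < k) \sum_(j < n | P (mxvec_index i j)) G (mxvec_index i j).
Proof.
rewrite pair_big_dep (reindex (fun ij => mxvec_index ij.1 ij.2))//=.
exists (@unsmash k n) => [[i j] _|c _]; first exact: mxvec_indexK.
exact: unsmashK.
Qed.

Lemma lift_mxvec_index k n (i : 'I_k) (j : 'I_n) :
  fintype.lift ord0 (mxvec_index i j) =
  smash_pt (fintype.lift ord0 i) (fintype.lift ord0 j).
Proof. by rewrite /smash_pt !liftK. Qed.

Lemma smash_pt_eq_lift k n (a : 'I_k.+1) (b : 'I_n.+1) (i : 'I_k) (j : 'I_n) :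
  (smash_pt a b == fintype.lift ord0 (mxvec_index i j)) =
  (a == fintype.lift ord0 i) && (b == fintype.lift ord0 j).
Proof.
case: (unliftP ord0 a) => [i'|] ->; last first.
  by rewrite smash_pt0l !(negbTE (neq_lift _ _)).
case: (unliftP ord0 b) => [j'|] ->; last first.
  by rewrite smash_pt0r !(negbTE (neq_lift _ _)) andbF.
rewrite -lift_mxvec_index !(inj_eq lift_inj).
apply/eqP/andP => [e|[/eqP-> /eqP->]//].
by have := congr1 (@unsmash k n) e; rewrite !mxvec_indexK => -[-> ->].
Qed.

Lemma Hmap_smash k k' n n' (f : gmap k k') (g : gmap n n')
    (x : {ffun 'I_(k * n) -> A}) (i' : 'I_k') (j' : 'I_n') :
  Hmap (smash f g) x (mxvec_index i' j') =
  \sum_(i < k | f (fintype.lift ord0 i) == fintype.lift ord0 i')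
    \sum_(j < n | g (fintype.lift ord0 j) == fintype.lift ord0 j')
      x (mxvec_index i j).
Proof.
rewrite ffunE big_mxvec_index [RHS]big_mkcond /=; apply: eq_bigr => i _.
case: ifPn => fi; last first.
  rewrite big_pred0// => j.
  by rewrite lift_mxvec_index [smash_fun _ _ _]smashE smash_pt_eq_lift (negbTE fi).
apply: eq_bigl => j.
by rewrite lift_mxvec_index [smash_fun _ _ _]smashE smash_pt_eq_lift fi.
Qed.

Lemma ffun_mxvec_ext k n (x y : {ffun 'I_(k * n) -> A}) :
  (forall i j, x (mxvec_index i j) = y (mxvec_index i j)) -> x = y.
Proof. by move=> xy; apply/ffunP => c; rewrite -(unsmashK c). Qed.

End SmashMatrix.

(** A family natural in n_+ is determined by its value on 1_+: the entry (i, j)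
    of u x is recovered by pushing forward along the pointed map n_+ -> 1_+ that
    keeps only j, and additivity comes from the fold map 2_+ -> 1_+. *)
Section NaturalMatrices.
Variables (A B : zmodType) (k : nat).
Variable u : forall n, {ffun 'I_n -> A} -> {ffun 'I_(k * n) -> B}.
Hypothesis u_nat : forall n m (f : gmap n m) x,
  u (Hmap f x) = Hmap (smash (gid k) f) (u x).

Let one (a : A) : {ffun 'I_1 -> A} := [ffun=> a].
Let entry (i : 'I_k) (a : A) : B := u (one a) (mxvec_index i ord0).

Fact pick_subproof n (j : 'I_n) :
  (fun c : 'I_n.+1 => if c == fintype.lift ord0 j then fintype.lift ord0 ord0 else ord0 : 'I_2)
    ord0 = ord0.
Proof. by []. Qed.
Let pick n (j : 'I_n) : gmap n 1 := GMap (pick_subproof j).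

Fact fold_subproof n :
  (fun c : 'I_n.+1 => if c == ord0 then ord0 else fintype.lift ord0 ord0 : 'I_2) ord0 = ord0.
Proof. by []. Qed.
Let fold n : gmap n 1 := GMap (fold_subproof n).

Lemma natural_entry n (x : {ffun 'I_n -> A}) i j :
  u x (mxvec_index i j) = entry i (x j).
Proof.
have pickE (j' : 'I_n) : (pick j (fintype.lift ord0 j') == fintype.lift ord0 ord0) = (j' == j).
  by rewrite /= (inj_eq lift_inj); case: ifP.
rewrite /entry; have -> : one (x j) = Hmap (pick j) x.
  apply/ffunP => l; rewrite !ffunE (ord1 l).
  by under eq_bigl => j' do rewrite pickE; rewrite big_pred1_eq.
rewrite u_nat Hmap_smash (big_pred1 i) => [|i']; last by rewrite /= (inj_eq lift_inj).
by under eq_bigl => j' do rewrite pickE; rewrite big_pred1_eq.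
Qed.

Lemma natural_entry_zmod i : zmod_morphism (entry i).
Proof.
have eD a b : entry i (a + b) = entry i a + entry i b.
  pose x : {ffun 'I_2 -> A} := [ffun j => if j == ord0 then a else b].
  have foldE (j : 'I_2) : (fold 2 (fintype.lift ord0 j) == fintype.lift ord0 ord0) = true.
    by [].
  rewrite {1}/entry; have -> : one (a + b) = Hmap (fold 2) x.
    apply/ffunP => l; rewrite !ffunE (ord1 l).
    by under eq_bigl => j do rewrite foldE; rewrite big_ord_recl big_ord1 !ffunE.
  rewrite u_nat Hmap_smash (big_pred1 i) => [|i']; last by rewrite /= (inj_eq lift_inj).
  under eq_bigl => j do rewrite foldE.
  by rewrite big_ord_recl big_ord1 !natural_entry !ffunE.
by move=> a b; apply: (addIr (entry i b)); rewrite -eD !subrK.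
Qed.

Lemma natural_matrix : exists chi : 'I_k -> {additive A -> B},
  forall n (x : {ffun 'I_n -> A}) i j, u x (mxvec_index i j) = chi i (x j).
Proof.
exists (fun i => HB.pack_for {additive A -> B} (entry i)
  (GRing.isZmodMorphism.Build A B (entry i) (natural_entry_zmod i))).
exact: natural_entry.
Qed.

End NaturalMatrices.

(** * The duality isomorphism *)

Lemma signed_iso_of_bijective (E F : SignedSmodule) (f : SignedHom E F) :
  (forall k, injective (f k)) -> (forall k (y : F k), exists x : E k, f k x = y) ->
  signed_iso E F.
Proof.
move=> finj fsurj.
pose g k (y : F k) : E k := sval (cid (fsurj k y)).
have gK k : cancel (g k) (f k) by move=> y; rewrite /g; case: cid.
have fK k : cancel (f k) (g k) by move=> x; apply: finj; exact: gK.
have gb k : g k (sbase F k) = sbase E k by apply: finj; rewrite gK smor_base.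
have gn k l (a : gmap k l) (y : F k) : g l (smap F a y) = smap E a (g k y).
  by apply: finj; rewrite gK smor_nat gK.
have gs s k (y : F k) : g k (sact (ssign F) s y) = sact (ssign E) s (g k y).
  by apply: finj; rewrite gK spmor_sign gK.
by exists f, (@Spmor F E (Smor gb gn) gs).
Qed.

Section Duality.
Variables (R : realType) (D : arakelov R).
Local Notation K := (canonical_divisor R).
Local Notation U := (U1 (4^-1 : R)%:pos).

Definition char_mx k (q : {ffun 'I_k -> rat}) n (x : {ffun 'I_n -> adele R}) :
    {ffun 'I_(k * n) -> RmodZ R} :=
  [ffun c => adele_char D (ratr (q (unsmash c).1 / 4)) (x (unsmash c).2)].

Lemma char_mxE k (q : {ffun 'I_k -> rat}) n (x : {ffun 'I_n -> adele R}) i j :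
  char_mx q x (mxvec_index i j) = adele_char D (ratr (q i / 4)) (x j).
Proof. by rewrite ffunE mxvec_indexK. Qed.

Definition integral_family k (q : {ffun 'I_k -> rat}) : Prop :=
  forall i, Ofin (K - D) (finite_diag (q i)).

Lemma char_mx_nat k (q : {ffun 'I_k -> rat}) n m (f : gmap n m) x :
  integral_family q -> char_mx q (Hmap f x) = Hmap (smash (gid k) f) (char_mx q x).
Proof.
move=> qD; apply: ffun_mxvec_ext => i j.
rewrite Hmap_smash (big_pred1 i) => [|i']; last by rewrite /= (inj_eq lift_inj).
have cB := adele_char_zmod (dual_of_Ofin (qD i)).
pose chi : {additive adele R -> RmodZ R} := HB.pack_for {additive adele R -> RmodZ R}
  (adele_char D (ratr (q i / 4))) (GRing.isZmodMorphism.Build _ _ _ cB).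
rewrite char_mxE ffunE -[adele_char _ _]/(chi : _ -> _) raddf_sum.
by apply: eq_bigr => j' _; rewrite char_mxE.
Qed.

Lemma char_mx0 k (q : {ffun 'I_k -> rat}) n :
  integral_family q -> char_mx q (0 : {ffun 'I_n -> adele R}) = 0.
Proof.
move=> qD; apply: ffun_mxvec_ext => i j; rewrite char_mxE !ffunE.
have := adele_char_zmod (dual_of_Ofin (qD i)) 0 0; rewrite !subrr; exact.
Qed.

(** The norm of entry (i, j) of the difference is at most |q_i t_j / 4|, where t
    is the real part of the element of HO(D)(n_+); the double sum factors, and
    the two degrees at infinity cancel. *)
Lemma char_mx_tol k (q : {ffun 'I_k -> rat}) n (x y : {ffun 'I_n -> adele R}) :
  H0_mem (K - D) q -> H1_tol D x y -> U1_tol (4^-1 : R)%:pos (char_mx q x) (char_mx q y).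
Proof.
move=> [qD qs] [r [b [[bD bs] xy]]]; rewrite /U1_tol /= big_mxvec_index.
have cD i := dual_of_Ofin (qD i).
apply: (@le_trans _ _ (\sum_(i < k) \sum_(j < n) `|ratr (q i / 4) * (b j).2|)).
  apply: ler_sum => i _; apply: ler_sum => j _.
  rewrite !char_mxE -(adele_char_zmod (cD i)).
  have := congr1 (fun z : {ffun 'I_n -> adele R} => z j) xy; rewrite !ffunE => ->.
  rewrite (@adele_charE _ D _ _ (r j) (b j).1) //= addrC addKr.
  exact: norm_toRZ_le.
under eq_bigr => i _ do under eq_bigr => j _ do rewrite normrM rmorphM normrM.
under eq_bigr do rewrite -mulr_sumr.
rewrite -mulr_suml -mulr_suml fmorphV /= rmorph_nat ger0_norm ?invr_ge0//.
rewrite mulrAC -[leRHS]mul1r ler_pM2r ?invr_gt0//.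
have -> : 1 = expR (K - D).2 * expR D.2 by rewrite -expRD /= sub0r addNr expR0.
by apply: ler_pM => //; exact: sumr_ge0.
Qed.

Definition duality_hom k (q : H0 (K - D) k) : ihom (H1 D) U k.
Proof.
unshelve refine (@Tmor (H1 D) (Defs.shift k U) (@Smor (H1 D) (Defs.shift k U)
  (fun n x => @char_mx k (sval q) n x) _ _) _).
- by move=> n; exact: (char_mx0 _ (svalP q).1).
- by move=> n m f x; exact: (char_mx_nat f x (svalP q).1).
- by move=> n x y; exact: (char_mx_tol (svalP q)).
Defined.

Definition duality : SignedHom (H0 (K - D)) (ihom (H1 D) U).
Proof.
unshelve refine (@Spmor _ _ (@Smor (H0 (K - D)) (ihom (H1 D) U) duality_hom _ _) _).
- move=> k; apply: tmor_ext => n x; apply: ffun_mxvec_ext => i j.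
  by rewrite [LHS]char_mxE !ffunE mul0r rmorph0 adele_char0.
- move=> k l f q; apply: tmor_ext => n x; apply: ffun_mxvec_ext => i j.
  rewrite [LHS]char_mxE [RHS]Hmap_smash.
  have -> : adele_char D (ratr (Hmap f (sval q) i / 4)) (x j) =
      \sum_(i' | f (fintype.lift ord0 i') == fintype.lift ord0 i)
        adele_char D (ratr (sval q i' / 4)) (x j).
    rewrite ffunE mulr_suml rmorph_sum /=.
    apply: (big_morph (fun c => adele_char D c (x j))) => [c d|].
      exact: adele_charD.
    exact: adele_char0.
  apply: eq_bigr => i' _; rewrite (big_pred1 j) => [|j'].
    by rewrite char_mxE.
  by rewrite /= (inj_eq lift_inj).
- move=> [] k q; apply: tmor_ext => n x //; apply: ffun_mxvec_ext => i j.
  rewrite [LHS]char_mxE [RHS]ffunE char_mxE /= ffunE mulNr rmorphN.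
  exact: adele_charN.
Defined.

(** A frequency is determined by its character on the real adeles. *)
Lemma duality_inj k : injective (duality k).
Proof.
move=> q q' qq'.
have e (x : {ffun 'I_1 -> adele R}) : char_mx (sval q) x = char_mx (sval q') x.
  exact: (congr1 (fun u : TolHom (H1 D) (Defs.shift k U) => u 1%N x) qq').
suff : sval q = sval q' by case: q q' {qq' e} => [q qP] [q' qP'] /= ?; exact: eq_exist.
apply/ffunP => i.
have cD (q0 : H0 (K - D) k) := dual_of_Ofin ((svalP q0).1 i).
have et (t : R) : toRZ (ratr (sval q i / 4) * t) = toRZ (ratr (sval q' i / 4) * t).
  have := congr1 (fun y : {ffun _ -> _} => y (mxvec_index i ord0)) (e [ffun=> (0, t)]).
  by rewrite !char_mxE !ffunE !adele_char_real.
have : ratr (sval q i / 4) - ratr (sval q' i / 4) = 0 :> R.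
  by apply: toRZ_mul_eq0 => t; rewrite mulrBl raddfB /= et subrr.
move/eqP; rewrite -rmorphB fmorph_eq0 -mulrBl mulf_eq0 invr_eq0 pnatr_eq0 orbF subr_eq0.
by move/eqP.
Qed.

(** Tolerance is used only between 0 and the points of Q^n + HO(D)(n_+); for
    additive maps this is the whole of its content. *)
Lemma ihom_matrix k (u : ihom (H1 D) U k) :
  exists2 chi : 'I_k -> {additive adele R -> RmodZ R},
    (forall n (x : {ffun 'I_n -> adele R}) i j,
       (u : TolHom (H1 D) (Defs.shift k U)) n x (mxvec_index i j) = chi i (x j)) &
    (forall n (r : {ffun 'I_n -> rat}) (b : {ffun 'I_n -> adele R}), HO D b ->
       \sum_(i < k) \sum_(j < n) norm_RmodZ (chi i (diag R (r j) + b j)) <= 4^-1).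
Proof.
have [chi uE] := natural_matrix (u := fun n => (u : TolHom _ _) n)
  (fun n m f x => smor_nat (u : TolHom _ _) f x).
exists chi => // n r b bD.
pose x : {ffun 'I_n -> adele R} := [ffun j => diag R (r j) + b j].
have : H1_tol D x 0.
  by exists r, b; split=> //; rewrite subr0; apply/ffunP => j; rewrite !ffunE.
move=> /(tmor_tol (u : TolHom (H1 D) (Defs.shift k U))).
rewrite /= /U1_tol /= big_mxvec_index; apply: le_trans.
apply: ler_sum => i _; apply: ler_sum => j _.
have e0 := smor_base (u : TolHom (H1 D) (Defs.shift k U)) n.
by rewrite /= in e0; rewrite e0 uE !ffunE subr0.
Qed.

(** Each character vanishes on Q + O(D)_f because that subgroup lands in the
    ball of radius 1/4, and is linear on the reals by [real_character]; that
    the frequencies are dual is the vanishing on Q read on the real component. *)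
Lemma duality_surj k (u : ihom (H1 D) U k) : exists q, duality k q = u.
Proof.
have [chi uE chi_small] := ihom_matrix u.
have chi_fin i (r : rat) (b : finite_adele) : Ofin D b -> chi i (diag R r + (b, 0)) = 0.
  move=> bD; apply: small_multiples_eq0 => n; rewrite -raddfMn.
  have bnD : HO D ([ffun=> (b *+ n, 0)] : {ffun 'I_1 -> adele R}).
    split=> [j|]; last by rewrite big_ord1 ffunE normr0 expR_ge0.
    rewrite ffunE /=; elim: n => [|n IH]; first by rewrite mulr0n; exact: Ofin0.
    by rewrite mulrS; apply: OfinD.
  have := chi_small 1%N [ffun=> r *+ n] _ bnD.
  under eq_bigr do rewrite big_ord1 !ffunE.
  rewrite (bigD1 i)//= => le4; apply: le_trans le4.
  have -> : (diag R r + (b, 0)) *+ n = diag R (r *+ n) + (b *+ n, 0).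
    rewrite mulrnDl raddfMn; congr (_ + _).
    by elim: n {bnD} => [|n IH]; rewrite ?mulr0n// !mulrS IH; congr pair; rewrite /= addr0.
  by rewrite lerDl; apply: sumr_ge0 => *; exact: norm_RmodZ_ge0.
(* Half of the radius of O(D) at infinity: two copies of t fit when |t| <= M,
   which improves the bound 1/4 to the 1/8 that real_character asks for. *)
pose M : R := expR D.2 / 2.
have M0 : 0 < M by rewrite divr_gt0 ?expR_gt0.
have chi_real (t : R) : `|t| <= M -> 2 * \sum_i norm_RmodZ (chi i (0, t)) <= 4^-1.
  move=> tM; have bD : HO D ([ffun=> (0, t)] : {ffun 'I_2 -> adele R}).
    split=> [j|]; first by rewrite ffunE; exact: Ofin0.
    under eq_bigr do rewrite ffunE /=.
    rewrite big_ord_recl big_ord1; move: tM; rewrite /M; lra.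
  have := chi_small 2%N 0 _ bD; apply: le_trans.
  rewrite mulr_sumr; apply: ler_sum => i _.
  rewrite big_ord_recl big_ord1 !ffunE raddf0 add0r; lra.
pose real_incl (t : R) : adele R := (0, t).
have real_inclB : zmod_morphism real_incl.
  by move=> s t; rewrite /real_incl; congr pair; rewrite /= subr0.
pose inc : {additive R -> adele R} := HB.pack_for {additive R -> adele R} real_incl
  (GRing.isZmodMorphism.Build _ _ _ real_inclB).
pose h i : {additive R -> RmodZ R} := chi i \o inc.
have /choice[c cP] i : exists c, `|c| * M = norm_RmodZ (h i M) /\ forall t, h i t = toRZ (c * t).
  have [|c c1 c2] := real_character (h := h i) M0; last by exists c.
  move=> t /chi_real; rewrite (bigD1 i)//=.
  have : 0 <= \sum_(i0 < k | i0 != i) norm_RmodZ (chi i0 (0, t)).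
    by apply: sumr_ge0 => *; exact: norm_RmodZ_ge0.
  rewrite /inc /= /real_incl; lra.
have cD i : dual_frequency D (c i).
  move=> r rD; apply/toRZ_eq0; rewrite -(cP i).2.
  have -> : h i (ratr r) = chi i (diag R r + ((- finite_diag r), 0)).
    by congr (chi i _); rewrite /= /real_incl; congr pair; rewrite /= ?subrr ?addr0.
  by apply: chi_fin; exact: OfinN.
have /choice[q qP] i : exists q : rat,
    Ofin (K - D) (finite_diag q) /\ c i = ratr (q / 4).
  by have [q q1 q2] := Ofin_of_dual (cD i); exists q.
have qD : H0_mem (K - D) [ffun i => q i].
  split=> [i|]; first by rewrite ffunE; exact: (qP i).1.
  have := @chi_real M; rewrite (ger0_norm (ltW M0)) lexx => /(_ isT).
  under eq_bigr => i _.
    rewrite -[chi i _]/(h i M) -(cP i).1 (qP i).2 rmorphM normrM fmorphV /=.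
    rewrite rmorph_nat [`|4^-1|]ger0_norm ?invr_ge0//.
    over.
  under [X in _ -> X <= _]eq_bigr do rewrite ffunE.
  rewrite -mulr_suml -mulr_suml; set S := \sum_(i < k) _.
  rewrite /= sub0r expRN /M => le4.
  rewrite -[leRHS]mul1r ler_pdivlMr ?expR_gt0//; lra.
exists (exist _ _ qD); apply: tmor_ext => n x; apply: ffun_mxvec_ext => i j.
rewrite [LHS]char_mxE [RHS]uE /= ffunE -(qP i).2 /adele_char -(cP i).2.
have [r [b [bD xE]]] := adele_decomp D (x j).
by rewrite [in RHS]xE [RHS]raddfD /= chi_fin// add0r.
Qed.

End Duality.

(** * The dualizing module as H^1 of the canonical divisor *)

Section CanonicalH1.
Variable R : realType.
Local Notation K := (canonical_divisor R).
Local Notation U := (U1 (4^-1 : R)%:pos).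

Lemma dual_frequency_quarter : dual_frequency K (4^-1 : R).
Proof.
have -> : (4^-1 : R) = ratr (1 / 4) by rewrite mul1r fmorphV /= rmorph_nat.
apply: dual_of_Ofin => p.
by rewrite subrr coeff0 oppr0; exact: (pZp_int p 1).
Qed.

(** Lifts r of the value at z are the same thing as decompositions of z with real
    coordinate 4 r: two lifts differ by an integer n, and 4 n is a rational in
    O(K)_f that can be moved to the other two summands. *)
Lemma quarter_char_lift (z : adele R) (r : R) : toRZ r = adele_char K 4^-1 z ->
  exists q b, Ofin K b /\ z = diag R q + (b, 4 * r).
Proof.
have [q [b [bK zE]]] := adele_decomp K z.
rewrite /adele_char => /eqP; rewrite -subr_eq0 -raddfB => /eqP/toRZ_eq0/intrP[n rn].
exists (q - n%:~R * 4), (b + finite_diag (n%:~R * 4)); split.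
  apply: OfinD => // p; rewrite /= (ratr_QpM p _ 4) -[X in pZp X]add0r.
  by apply: pZpM; [exact: pZp_int|exact: pZp_four].
rewrite [LHS]zE raddfB /= -!addrA; congr (_ + _); rewrite /diag.
congr pair => /=; first by rewrite addr0 addrCA addNr addr0.
rewrite rmorphM /= ratr_int ratr_nat -rn; lra.
Qed.

Lemma quarter_char_real (r : R) : adele_char K 4^-1 (0, 4 * r) = toRZ r.
Proof. by rewrite adele_char_real ?mulKf//; exact: dual_frequency_quarter. Qed.

Definition quarter_map k (x : {ffun 'I_k -> adele R}) : {ffun 'I_k -> RmodZ R} :=
  [ffun i => adele_char K 4^-1 (x i)].

Lemma quarter_map_tol k (x y : {ffun 'I_k -> adele R}) :
  H1_tol K x y <-> U1_tol (4^-1 : R)%:pos (quarter_map x) (quarter_map y).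
Proof.
rewrite /U1_tol /=.
under eq_bigr => i _ do rewrite !ffunE -(adele_char_zmod dual_frequency_quarter).
split=> [[q [b [[bD bs] xy]]]|le4].
  apply: (@le_trans _ _ (\sum_(i < k) `|4^-1 * (b i).2|)).
    apply: ler_sum => i _.
    have := congr1 (fun z : {ffun 'I_k -> adele R} => z i) xy; rewrite !ffunE => ->.
    rewrite (@adele_charE _ K _ _ (q i) (b i).1) //=; last exact: dual_frequency_quarter.
    by rewrite addrC addKr; exact: norm_toRZ_le.
  under eq_bigr do rewrite normrM ger0_norm ?invr_ge0//.
  by rewrite -mulr_sumr ger_pMr ?invr_gt0//; move: bs; rewrite /= expR0.
(* The shortest lifts r i turn the bound on norms into a bound on the real
   coordinates 4 * r i. *)
have /choice[r rP] i : exists r, toRZ r = adele_char K 4^-1 (x i - y i) /\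
    norm_RmodZ (adele_char K 4^-1 (x i - y i)) = `|r|.
  by have [r r1 r2] := norm_RmodZ_lift (adele_char K 4^-1 (x i - y i)); exists r.
have /choice[qb qbP] i : exists qb : rat * finite_adele,
    Ofin K qb.2 /\ x i - y i = diag R qb.1 + (qb.2, 4 * r i).
  by have [q [b ?]] := quarter_char_lift (rP i).1; exists (q, b).
exists [ffun i => (qb i).1], [ffun i => ((qb i).2, 4 * r i)]; split.
  split=> [i|]; first by rewrite ffunE; exact: (qbP i).1.
  under eq_bigr do rewrite ffunE /= normrM normr_nat -(rP _).2.
  rewrite -mulr_sumr /= expR0; lra.
by apply/ffunP => i; rewrite !ffunE (qbP i).2.
Qed.

Lemma quarter_map_eq k (x y : {ffun 'I_k -> adele R}) :
  quarter_map x = quarter_map y <-> forall i, QOfin K (x i - y i).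
Proof.
split=> [/ffunP xy i|xy].
  have [|q [b [bK e]]] := @quarter_char_lift (x i - y i) 0.
    have := xy i; rewrite !ffunE (adele_char_zmod dual_frequency_quarter) => ->.
    by rewrite subrr raddf0.
  by exists q, b; rewrite e mulr0.
apply/ffunP => i; have [q [b [bK e]]] := xy i; rewrite !ffunE.
apply/eqP; rewrite -subr_eq0 -(adele_char_zmod dual_frequency_quarter) e.
rewrite (@adele_charE _ K _ _ q b) //=; last exact: dual_frequency_quarter.
by rewrite addr0 subrr mulr0 raddf0.
Qed.

Lemma quarter_mapB k : zmod_morphism (@quarter_map k).
Proof.
by move=> x y; apply/ffunP => i; rewrite !ffunE (adele_char_zmod dual_frequency_quarter).
Qed.

Definition quarter_hom : TolSignedHom (H1 K) U.
Proof.
unshelve refine (@Tspmor (H1 K) U (@Tmor (H1 K) U (@Smor (H1 K) U quarter_map _ _) _) _).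
- by move=> k; have := quarter_mapB (0 : {ffun 'I_k -> adele R}) 0; rewrite !subrr.
- move=> k l f x; apply/ffunP => j; rewrite !ffunE.
  pose chi : {additive adele R -> RmodZ R} := HB.pack_for {additive adele R -> RmodZ R}
    (adele_char K 4^-1) (GRing.isZmodMorphism.Build _ _ _ (adele_char_zmod dual_frequency_quarter)).
  rewrite -[adele_char _ _]/(chi : _ -> _) raddf_sum.
  by apply: eq_bigr => i _; rewrite ffunE.
- by move=> k x y xy; apply/quarter_map_tol.
- move=> [] k x //; have := quarter_mapB 0 (x : {ffun 'I_k -> adele R}).
  rewrite !sub0r => /= ->.
  by have := quarter_mapB (0 : {ffun 'I_k -> adele R}) 0; rewrite !subrr => ->; rewrite sub0r.
Defined.

Lemma deg_canonical : arakelov_deg K = - 2 * ln 2.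
Proof.
rewrite /arakelov_deg /= domU// big_seq1 coeffU eqxx mulr1 addr0.
by rewrite mulrNz.
Qed.

End CanonicalH1.

Theorem theorem1p2 (R : realType) (D : arakelov R) :
  let K := canonical_divisor R in
  let U := U1 (4^-1 : R)%:pos in
  [/\ arakelov_deg K = - 2 * ln 2,
      signed_iso (H0 (K - D)) (ihom (H1 D) U) &
      (* U(1)_{1/4} is H^1(K) read on A_Q / (Q + O(K)_f) *)
      exists pi : TolSignedHom (H1 K) U,
        forall k : nat,
          [/\ forall y : U k, exists x : H1 K k, pi k x = y,
              forall x y : H1 K k, tol x y <-> tol (pi k x) (pi k y) &
              forall x y : {ffun 'I_k -> adele R},
                pi k x = pi k y <-> forall i, QOfin K (x i - y i)]].
Proof.
split; first exact: deg_canonical.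
  apply: (signed_iso_of_bijective (f := duality D)).
    exact: duality_inj.
  exact: duality_surj.
exists (quarter_hom R) => k; split=> [y|x y|x y].
- pose r i := sval (cid2 (norm_RmodZ_lift ((y : {ffun 'I_k -> RmodZ R}) i))).
  exists ([ffun i => (0, 4 * r i)] : {ffun 'I_k -> adele R}).
  apply/ffunP => i; rewrite !ffunE quarter_char_real.
  by rewrite /r; case: cid2.
- exact: quarter_map_tol.
- exact: quarter_map_eq.
Qed.
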